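(* For each integer $p\ge1$, with $n=p+1$, let $$\zeta_{p,1}(s)=-\,\frac{n^n}{p^p}\,\frac{s}{(1-s)^n},$$ which defines a degree-$n$ Belyi map $\mathbb{P}^1_s\to\mathbb{P}^1_\zeta$. Then for all $a\in\mathbb{C}$ and $\ell\in\mathbb{Z}$, one has near $s=0$ $${}_nF_{n-1}\left(\begin{array}{l}\frac{a}n,\dots,\frac{a+(n-1)}n\\ \frac{a-\ell+1}p,\dots,\frac{a-\ell+p}p\end{array}\mid\zeta_{p,1}(s)\right)=(1-s)^a\,F_\ell\left(-a,-p;\,(1-s)^{-1}\right).$$ Moreover, for all $a,c\in\mathbb{C}$ and $\ell=0,1$, one has near $s=0$ $${}_{n+1}F_{n}\left(\begin{array}{l}\frac{a}n,\dots,\frac{a+(n-1)}n;\ \frac{a+c-\ell}p\\ \frac{a-\ell}p,\dots,\frac{a-\ell+(p-1)}p;\ \frac{a+c-\ell+p}p\end{array}\mid\zeta_{p,1}(s)\right)=(1-s)^a\,G_\ell\left(-a,-p,-c;\,(1-s)^{-1}\right).$$ Here $a$ (and $c$) are assumed to be such that no lower hypergeometric parameter is a non-positive integer and no division by zero occurs.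
   Context: A Belyi map is a holomorphic map to $\mathbb{P}^1_\zeta$ ramified only over $\zeta=0,1,\infty$. Complex powers near $1$ are principal. Notation: ${}_{m}F_{m-1}(a_1,\dots,a_m;b_1,\dots,b_{m-1};\zeta)=\sum_{k\ge0}\frac{(a_1)_k\cdots(a_m)_k}{(b_1)_k\cdots(b_{m-1})_k(1)_k}\zeta^k$. For $c\in\mathbb{C}$, $(c)_r=c(c+1)\cdots(c+r-1)$ for $r\ge0$ and $(c)_{-s}=[(c-s)\cdots(c-1)]^{-1}$ for $s\ge0$; $\binom{c}{r}=(c-r+1)_r/r!$. Rational functions $F_\ell$: for $\ell\in\mathbb{Z}$ and $B\ne0,1$ let $f_\ell(A,B;k)=\frac{(A+Bk+1)_{\ell-1}}{(A+1)_{\ell-1}}$ and $\hat f_\ell(A,B;r)=\sum_{k=0}^r(-1)^k\binom{r}{k}\binom{A+Bk}{r}f_\ell(A,B;k)$. Then $F_\ell(A,B;y)$ is the rational function of $y$ given near $y=1$ by $\sum_{r\ge0}\hat f_\ell(A,B;r)\left(\frac{1-y}{y}\right)^r$. E.g. $F_0\equiv1$, $F_1(A,B;y)=\frac{y}{(1-B)y+B}$. Functions $G_0,G_1$: $G_0(A,B,C;y)={}_2F_1\left(C,1;\frac{A+C}B+1;\frac{y-1}y\right)$ and $G_1(A,B,C;y)=\frac{y}{(1-B)y+B}\;{}_3F_2\left(C,\frac{A+1}{B-1}+1,1;\frac{A+C+1}{B}+1,\frac{A+1}{B-1};\frac{y-1}y\right)$. *)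

(* Defs.v *)
From HB Require Import structures.
From mathcomp Require Import all_boot all_order all_algebra.
From mathcomp Require Import complex.
From mathcomp Require Import all_classical all_reals all_analysis.

Set Implicit Arguments.
Unset Strict Implicit.
Unset Printing Implicit Defensive.

Import Order.TTheory GRing.Theory Num.Theory.
Import numFieldNormedType.Exports.

Local Open Scope classical_set_scope.
Local Open Scope ring_scope.

(* MathComp-Analysis does not equip the concrete type R[i] with the topology
   that it gives to every numFieldType; below, limits, neighbourhoods and
   derivatives on R[i] are the complex ones. *)
#[warnings="-redundant-canonical-projection"]
HB.instance Definition _ (R : realType) := NormedModule.copy R[i] R[i]^o.

Section ComplexPowers.
Variable R : realType.
Local Notation C := R[i].

Definition cexp (z : C) : C :=
  let: Complex x y := z in Complex (expR x * cos y) (expR x * sin y).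

(* The value lies in ]-pi, pi] for z != 0. *)
Definition carg (z : C) : R :=
  let: Complex x y := z in
  let t := acos (x / Num.sqrt (x ^+ 2 + y ^+ 2)) in
  if 0 <= y then t else - t.

Definition clog (z : C) : C :=
  let: Complex x y := z in
  Complex (ln (Num.sqrt (x ^+ 2 + y ^+ 2))) (carg z).

(* Principal power; only meaningful for z != 0. *)
Definition cpow (z a : C) : C := cexp (a * clog z).

End ComplexPowers.

Section Hypergeometric.
Variable R : realType.
Local Notation C := R[i].

Definition poch (c : C) (r : nat) : C := \prod_(i < r) (c + i%:R).

(* (c)_m for m in Z; [Negz r] is -(r+1) *)
Definition pochz (c : C) (m : int) : C :=
  match m with
  | Posz r => poch c r
  | Negz r => (\prod_(1 <= i < r.+2) (c - i%:R))^-1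
  end.

(* The definition of (c)_m involves no division by zero. *)
Definition pochz_defined (c : C) (m : int) : Prop :=
  match m with
  | Posz _ => True
  | Negz r => \prod_(1 <= i < r.+2) (c - i%:R) != 0
  end.

Definition cbinom (c : C) (r : nat) : C := poch (c - r%:R + 1) r / r`!%:R.

(* al and be list the upper and the lower parameters. *)
Definition hyp_term (al be : seq C) (z : C) (k : nat) : C :=
  (\prod_(a <- al) poch a k) / ((\prod_(b <- be) poch b k) * poch 1 k) * z ^+ k.

Definition hyp_cvg (al be : seq C) (z : C) : Prop :=
  cvgn (series (hyp_term al be z)).

Definition hyp (al be : seq C) (z : C) : C := limn (series (hyp_term al be z)).

Definition lower_ok (be : seq C) : Prop :=
  forall b, b \in be -> forall m : nat, b != - m%:R.

End Hypergeometric.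

Section FunctionsFG.
Variable R : realType.
Local Notation C := R[i].

Definition f_coef (l : int) (A B : C) (k : nat) : C :=
  pochz (A + B * k%:R + 1) (l - 1) / pochz (A + 1) (l - 1).

(* The definition of f_coef l A B k involves no division by zero. *)
Definition f_coef_defined (l : int) (A B : C) (k : nat) : Prop :=
  [/\ pochz_defined (A + B * k%:R + 1) (l - 1),
      pochz_defined (A + 1) (l - 1)
    & pochz (A + 1) (l - 1) != 0].

Definition fhat (l : int) (A B : C) (r : nat) : C :=
  \sum_(0 <= k < r.+1)
    (-1) ^+ k * 'C(r, k)%:R * cbinom (A + B * k%:R) r * f_coef l A B k.

(* PQ.1 / PQ.2, in lowest terms with monic denominator, is the rational
   function of y given near y = 1 by the defining series of F_l(A, B; y).
   There is at most one such pair. *)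
Definition is_F (l : int) (A B : C) (PQ : {poly C} * {poly C}) : Prop :=
  [/\ coprimep PQ.1 PQ.2, PQ.2 \is monic
    & \forall y \near (1 : C), PQ.2.[y] != 0 /\
        series (fun r => fhat l A B r * ((1 - y) / y) ^+ r) @ \oo -->
        (PQ.1.[y] / PQ.2.[y] : C)].

(* If no pair satisfied is_F, F would be the zero function. *)
Definition F (l : int) (A B y : C) : C :=
  let PQ := xget ((0, 1) : {poly C} * {poly C}) [set PQ | is_F l A B PQ] in
  PQ.1.[y] / PQ.2.[y].

Definition G0_up (A B Cc : C) : seq C := [:: Cc; 1].
Definition G0_low (A B Cc : C) : seq C := [:: (A + Cc) / B + 1].

Definition G0 (A B Cc y : C) : C :=
  hyp (G0_up A B Cc) (G0_low A B Cc) ((y - 1) / y).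

Definition G1_up (A B Cc : C) : seq C := [:: Cc; (A + 1) / (B - 1) + 1; 1].
Definition G1_low (A B Cc : C) : seq C :=
  [:: (A + Cc + 1) / B + 1; (A + 1) / (B - 1)].

Definition G1 (A B Cc y : C) : C :=
  y / ((1 - B) * y + B) * hyp (G1_up A B Cc) (G1_low A B Cc) ((y - 1) / y).

(* G_l for l = 0, 1 (every l other than 0 is read as 1) *)
Definition G_up (l : nat) := if l == 0%N then G0_up else G1_up.
Definition G_low (l : nat) := if l == 0%N then G0_low else G1_low.
Definition G (l : nat) := if l == 0%N then G0 else G1.

End FunctionsFG.

Section BelyiMaps.
Variable R : realType.
Local Notation C := R[i].

(* The Riemann sphere: Some z is the finite point z, None is infinity. *)
Definition P1 : Type := option C.

(* Inverse of the chart centred at x (z - x at a finite point x, 1/z at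
   infinity): the point with local coordinate w. *)
Definition of_chart (x : P1) (w : C) : P1 :=
  match x with
  | Some z => Some (z + w)
  | None => if w == 0 then None else Some w^-1
  end.

Definition chart_dom (x : P1) : set P1 :=
  match x with
  | Some _ => [set q | q <> None]
  | None => [set q | q <> Some 0]
  end.

(* The chart centred at x; its values outside chart_dom x are irrelevant. *)
Definition chart (x q : P1) : C :=
  match x, q with
  | Some z, Some z' => z' - z
  | None, Some z' => z'^-1
  | _, None => 0
  end.

Definition local_expr (f : P1 -> P1) (x : P1) (w : C) : C :=
  chart (f x) (f (of_chart x w)).

Definition holomorphic_at (f : P1 -> P1) (x : P1) : Prop :=
  (\forall w \near (0 : C), chart_dom (f x) (f (of_chart x w))) /\
  derivable (local_expr f x) 0 1.

Definition holomorphic (f : P1 -> P1) : Prop := forall x, holomorphic_at f x.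

Definition ramified_at (f : P1 -> P1) (x : P1) : Prop :=
  'D_1 (local_expr f x) 0 = 0.

Definition ramified_over (f : P1 -> P1) (q : P1) : Prop :=
  exists2 x, f x = q & ramified_at f x.

Definition Belyi_map (f : P1 -> P1) : Prop :=
  holomorphic f /\
  forall q, ramified_over f q -> [\/ q = Some 0, q = Some 1 | q = None].

(* The degree of a holomorphic map is the number of points in each fibre
   over which the map is not ramified. *)
Definition has_degree (f : P1 -> P1) (n : nat) : Prop :=
  forall q, ~ ramified_over f q -> (f @^-1` [set q] #= `I_n)%card.

Definition zeta (p : nat) (s : C) : C :=
  - (p.+1%:R ^+ p.+1 / p%:R ^+ p) * (s / (1 - s) ^+ p.+1).

(* zeta p as a map of the sphere: a pole at s = 1, a zero at infinity *)
Definition zetaP1 (p : nat) (x : P1) : P1 :=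
  match x with
  | Some s => if s == 1 then None else Some (zeta p s)
  | None => Some 0
  end.

End BelyiMaps.

(* Main.v *)
Require Import Defs.
From mathcomp Require Import all_boot all_order all_algebra.
From mathcomp Require Import complex.
From mathcomp Require Import all_classical all_reals all_analysis.
From mathcomp Require Import ring lra.
Import Order.TTheory GRing.Theory Num.Theory.
Import numFieldNormedType.Exports.
Import complex.ComplexField.Normc.
Local Open Scope classical_set_scope.
Local Open Scope ring_scope.

(* Write n = p + 1. Up to powers of n and p absorbed in the constant of
   zeta(s), the product of (a/n)_k, ..., ((a+n-1)/n)_k is (a)_{nk}, and likewise
   for the lower parameters. Expanding (1-s)^{-(a+nk)} by the binomial series
   and rearranging the absolutely convergent double series turns
   (1-s)^{-a} nF(n-1)(zeta(s)) into the sum over r of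
     s^r / r! * sum_k (-1)^k C(r,k) (a+pk)_r q_k,
   where q_k is f_l(-a,-p;k) in the first family and, with e = (a+c-l)/p,
   f_{l+1}(-a,-p;k) e/(e+k) in the second.
   In the first family this is the series defining F_l. It is rational: for
   l <= 0 the inner sum is eventually the r-th difference of a polynomial of
   degree < r, and for l >= 1, where q_k is a polynomial in k, multiplying q_k
   by k amounts to applying (s(1-s) d/ds - as)/(1+ps) to the series, starting
   from 1/(1+ps) for q = 1.
   In the second family the inner sum is a partial fraction expansion at k = -e,
   which gives the coefficients of G_0, and those of G_1 after multiplication of
   the series by 1+ps.
   The Belyi map has derivative proportional to (1+ps)/(1-s)^{n+1}, so its
   critical points are s = -1/p, of value 1, s = 1 and, for p > 1, infinity. *)

Set Implicit Arguments.
Unset Strict Implicit.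
Unset Printing Implicit Defensive.

(** * Series of complex numbers *)

Section ComplexSeries.
Variable R : realType.
Local Notation C := R[i].
Implicit Types (u v : nat -> C) (l z : C) (K th : R).

Lemma norm_normc z : `|z| = real_complex R (normc z).
Proof. by case: z. Qed.

Lemma normc_ge0 z : 0 <= normc z.
Proof. by rewrite -lecR -norm_normc normr_ge0. Qed.

Lemma normcB z z' : normc (z - z') = normc (z' - z).
Proof. by rewrite -normcN opprB. Qed.

Lemma normcX z n : normc (z ^+ n) = normc z ^+ n.
Proof.
by elim: n => [|n IH]; rewrite ?expr0 ?normc1// !exprS normcM IH.
Qed.

Lemma normc_nat n : normc (n%:R : C) = n%:R.
Proof. by rewrite normcMn normc1. Qed.

Lemma normc_real (x : R) : normc (real_complex R x) = `|x|.
Proof. by rewrite /= expr0n /= addr0 sqrtr_sqr. Qed.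

Lemma normc_sum (I : Type) (r : seq I) (P : pred I) (f : I -> C) :
  normc (\sum_(i <- r | P i) f i) <= \sum_(i <- r | P i) normc (f i).
Proof.
elim/big_ind2 : _ => [|x y z w hx hz|//]; first by rewrite normc0.
by rewrite (le_trans (le_normcD _ _))// lerD.
Qed.

Lemma ReB z w : complex.Re (z - w) = complex.Re z - complex.Re w.
Proof. by case: z; case: w. Qed.

Lemma ImB z w : complex.Im (z - w) = complex.Im z - complex.Im w.
Proof. by case: z; case: w. Qed.

Lemma abs_Re_le_normc z : `|complex.Re z| <= normc z.
Proof. by rewrite -lecR -norm_normc; exact: complex.normc_ge_Re. Qed.

Lemma abs_Im_le_normc z : `|complex.Im z| <= normc z.
Proof.
case: z => x y /=; rewrite -sqrtr_sqr ler_sqrt ?addr_ge0 ?sqr_ge0//.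
by rewrite lerDr sqr_ge0.
Qed.

Lemma normc_le_ReIm z : normc z <= `|complex.Re z| + `|complex.Im z|.
Proof.
case: z => x y /=; rewrite -[leRHS]ger0_norm ?addr_ge0// -sqrtr_sqr.
rewrite ler_sqrt ?sqr_ge0// sqrrD !real_normK ?num_real//.
by rewrite addrAC lerDl mulrn_wge0// mulr_ge0.
Qed.

Lemma squeeze_cvgn0 (f v : nat -> R) : (forall n, 0 <= f n <= v n) ->
  v @ \oo --> (0 : R) -> f @ \oo --> (0 : R).
Proof.
move=> h hv; apply: (@squeeze_cvgr _ _ _ _ (cst 0) v) => //.
  by apply: nearW => n; exact: h.
exact: cvg_cst.
Qed.

Lemma cvgn_dist0 (f : nat -> R) (x : R) :
  f @ \oo --> x -> (fun n => `|x - f n|) @ \oo --> (0 : R).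
Proof.
move=> /cvgrPdist_lt h; apply/cvgrPdist_lt => e /h.
by apply: filterS => n; rewrite sub0r normrN normr_id.
Qed.

(** The norm of [R[i]] takes its values in [R[i]], while the estimates below use the real-valued
    [normc]; this transfers limits from one to the other. *)
Lemma cvgC_normc u l :
  (fun n => normc (l - u n)) @ \oo --> (0 : R) <-> u @ \oo --> l.
Proof.
split=> [/cvgrPdist_lt h|/cvgrPdist_lt h].
  apply/cvgrPdist_lt => e e0.
  (* Positivity for the order of [R[i]] forces the imaginary part to vanish. *)
  have e_re : e = real_complex R (complex.Re e).
    by rewrite RRe_real// realE (ltW e0).
  have e0' : 0 < complex.Re e by rewrite -ltcR -e_re.
  apply: filterS (h _ e0') => n; rewrite sub0r normrN ger0_norm ?normc_ge0//.
  move=> hn; change (is_true (real_complex R (normc (l - u n)) < e)).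
  by rewrite e_re ltcR.
apply/cvgrPdist_lt => e e0.
have := h (real_complex R e); rewrite ltcR => /(_ e0).
apply: filterS => n hn; rewrite sub0r normrN ger0_norm ?normc_ge0//.
by rewrite -ltcR; exact: hn.
Qed.

Lemma cvgC_le u l (v : nat -> R) : (forall n, normc (l - u n) <= v n) ->
  v @ \oo --> (0 : R) -> u @ \oo --> l.
Proof.
move=> huv hv; apply/cvgC_normc.
by apply: squeeze_cvgn0 hv => n; rewrite normc_ge0 huv.
Qed.

Lemma cvgC_ReIm u l :
  (fun n => complex.Re (u n)) @ \oo --> complex.Re l ->
  (fun n => complex.Im (u n)) @ \oo --> complex.Im l -> u @ \oo --> l.
Proof.
move=> hR hI; have h := cvgD (cvgn_dist0 hR) (cvgn_dist0 hI).
rewrite addr0 in h.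
apply: (cvgC_le _ (h _)) => n; apply: (le_trans (normc_le_ReIm _)).
by rewrite ReB ImB.
Qed.

Lemma cvgC_ext u u' l : u' =1 u -> u' @ \oo --> l -> u @ \oo --> l.
Proof. by move=> /funext ->. Qed.

Lemma cvgCD u v l m : u @ \oo --> l -> v @ \oo --> m ->
  (fun n => u n + v n) @ \oo --> l + m.
Proof. by move=> hu hv; exact: (cvgD hu hv). Qed.

Lemma cvgCB u v l m : u @ \oo --> l -> v @ \oo --> m ->
  (fun n => u n - v n) @ \oo --> l - m.
Proof. by move=> hu hv; exact: (cvgB hu hv). Qed.

Lemma cvgCZ z u l : u @ \oo --> l -> (fun n => z * u n) @ \oo --> z * l.
Proof. by move=> hu; exact: (cvgM (cvg_cst z) hu). Qed.

Lemma cvgC_unique u l l' : u @ \oo --> l -> u @ \oo --> l' -> l = l'.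
Proof.
exact: (@cvg_unique _ (@norm_hausdorff _ C)).
Qed.

Lemma cvgC_lim u l : u @ \oo --> l -> limn u = l.
Proof. by move=> h; apply: (cvgC_unique (cvgP _ h) h). Qed.

Lemma Re_series u n :
  complex.Re (series u n) = series (fun k => complex.Re (u k)) n.
Proof.
rewrite /series /=; elim/big_ind2 : _ => [//|x x' y y' <- <-|//].
by case: x'; case: y'.
Qed.

Lemma Im_series u n :
  complex.Im (series u n) = series (fun k => complex.Im (u k)) n.
Proof.
rewrite /series /=; elim/big_ind2 : _ => [//|x x' y y' <- <-|//].
by case: x'; case: y'.
Qed.

Lemma geometric_partial_le K th m n : 0 <= K -> 0 <= th < 1 ->
  \sum_(m <= i < m + n) K * th ^+ i <= K * th ^+ m / (1 - th).
Proof.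
move=> K0 /andP[th0 th1]; rewrite -mulr_sumr geometric_partial_tail.
rewrite -mulrA ler_wpM2l// geometric_seriesE ?lt_eqF//=.
rewrite ler_wpM2r ?invr_ge0 ?subr_ge0 ?(ltW th1)//.
by rewrite ler_piMr ?exprn_ge0// gerBl exprn_ge0.
Qed.

(** Real and imaginary parts are dominated by the same geometric series. The explicit tail bound
    serves to control the row tails in [double_series]. *)
Lemma cvg_geometric_dominated u K th : 0 <= th < 1 ->
  (forall r, normc (u r) <= K * th ^+ r) ->
  exists l, series u @ \oo --> l /\
    forall N, normc (l - series u N) <= K * th ^+ N / (1 - th).
Proof.
move=> /andP[th0 th1] hu.
have K0 : 0 <= K by have := hu 0; rewrite mulr1; apply: le_trans (normc_ge0 _).
have th1' : `|th| < 1 by rewrite ger0_norm.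
have cK : cvgn (series (geometric K th)) by exact: is_cvg_geometric_series.
have cvgf (f : C -> R) : (forall z, `|f z| <= normc z) ->
    cvgn (series (fun k => f (u k))).
  move=> fle; apply: normed_cvg; rewrite /normed_series_of /=.
  apply: (series_le_cvg _ _ _ cK) => n /=; rewrite ?mulr_ge0 ?exprn_ge0//.
  exact: le_trans (fle _) (hu _).
have cR := cvgf _ abs_Re_le_normc; have cI := cvgf _ abs_Im_le_normc.
set l := Complex (limn (series (fun k => complex.Re (u k))))
                 (limn (series (fun k => complex.Im (u k)))).
have cu : series u @ \oo --> l.
  apply: cvgC_ReIm.
    rewrite (_ : (fun n => _) = series (fun k => complex.Re (u k)))//.
    by apply/funext => n; exact: Re_series.
  rewrite (_ : (fun n => _) = series (fun k => complex.Im (u k)))//.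
  by apply/funext => n; exact: Im_series.
exists l; split=> // N; apply/ler_addgt0Pr => e e0.
move/cvgC_normc/cvgrPdist_lt : cu => /(_ _ e0) [M _ hM].
have := hM (N + M)%N (leq_addl _ _).
rewrite sub0r normrN ger0_norm ?normc_ge0// => /ltW hlM.
have -> : l - series u N =
    (series u (N + M)%N - series u N) + (l - series u (N + M)%N) by ring.
rewrite (le_trans (le_normcD _ _))// lerD//.
rewrite sub_series_geq ?leq_addr// (le_trans (normc_sum _ _ _))//.
apply: le_trans (geometric_partial_le _ M K0 _); last by rewrite th0.
by apply: ler_sum => i _.
Qed.

(** Since n <= 2^n, the sequence is dominated by a multiple of (2 th)^n. *)
Lemma cvg_expr_mulrn K th : 0 <= th -> th < 2^-1 ->
  (fun n => K * (n%:R * th ^+ n)) @ \oo --> (0 : R).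
Proof.
move=> th0 th1.
have h : geometric 1 (2 * th) @ \oo --> (0 : R).
  by apply: cvg_geometric; rewrite ger0_norm; lra.
have h0 : (fun n => n%:R * th ^+ n) @ \oo --> (0 : R).
  apply: squeeze_cvgn0 h => n; rewrite mulr_ge0 ?exprn_ge0//= mul1r exprMn.
  rewrite ler_wpM2r ?exprn_ge0// -natrX ler_nat.
  by rewrite ltnW// ltn_expl.
by rewrite -(mulr0 K); exact: (cvgM (cvg_cst K) h0).
Qed.

(** The r-th diagonal has r + 1 <= 2^r terms of size at most K th^r, so the diagonal sums are
    dominated by a geometric series of ratio 2 th < 1. The row sums have the same limit, because a
    triangle of side N misses only N row tails, each O(th^N). *)
Lemma double_series (u : nat -> nat -> C) (v : nat -> C) K th :
  0 <= th -> th < 2^-1 ->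
  (forall k j, normc (u k j) <= K * th ^+ (k + j)) ->
  (forall k, series (u k) @ \oo --> v k) ->
  exists l, series v @ \oo --> l /\
    series (fun r => \sum_(0 <= k < r.+1) u k (r - k)%N) @ \oo --> l.
Proof.
move=> th0 th1 hu hv.
have K0 : 0 <= K.
  by have := hu 0 0; rewrite mulr1; apply: le_trans (normc_ge0 _).
pose d r := \sum_(0 <= k < r.+1) u k (r - k)%N.
have hd r : normc (d r) <= K * (2 * th) ^+ r.
  rewrite (le_trans (normc_sum _ _ _))//.
  have : \sum_(0 <= k < r.+1) normc (u k (r - k)%N) <=
         \sum_(0 <= k < r.+1) K * th ^+ r.
    by apply: ler_sum_nat => k /andP[_ kr]; rewrite -[X in th ^+ X](subnKC (ltnSE kr)).
  move=> /le_trans; apply; rewrite sumr_const_nat subn0 -[leLHS]mulr_natr.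
  rewrite exprMn mulrAC -mulrA ler_wpM2l// ler_wpM2r ?exprn_ge0//.
  by rewrite -natrX ler_nat ltn_expl.
have [|l [dl _]] := @cvg_geometric_dominated d K (2 * th) _ hd.
  by apply/andP; split; lra.
exists l; split=> //.
(* The factor 2 bounds 1 / (1 - th). *)
have tail k N : normc (v k - series (u k) N) <= K * th ^+ (k + N) * 2.
  have hk j : normc (u k j) <= K * th ^+ k * th ^+ j by rewrite -mulrA -exprD.
  have [|l' [ul' hl']] := cvg_geometric_dominated _ hk; first by rewrite th0; lra.
  rewrite (cvgC_unique (hv k) ul') (le_trans (hl' N))// exprD mulrA.
  rewrite ler_wpM2l ?mulr_ge0 ?exprn_ge0//.
  by rewrite -[leRHS]invrK lef_pV2 ?posrE; lra.
(* The first N diagonals, regrouped by rows. *)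
have key N : series d N = \sum_(0 <= k < N) series (u k) (N - k)%N.
  elim: N => [|N IH]; first by rewrite /series /= !big_nil.
  rewrite seriesSr IH big_nat_recr//= subSnn [series _ 1]/series /= big_nat1.
  rewrite [in RHS](eq_big_nat _ _ (F2 := fun k => series (u k) (N - k)%N + u k (N - k)%N)).
    by rewrite big_split /= -addrA /d big_nat_recr//= subnn.
  by move=> k /andP[_ kN]; rewrite subSn ?(ltnW kN)// seriesSr.
have hdv : (fun N => series v N - series d N) @ \oo --> (0 : C).
  apply: (cvgC_le _ (cvg_expr_mulrn (K * 2) th0 th1)) => N.
  rewrite sub0r normcN key /series /= -sumrB (le_trans (normc_sum _ _ _))//.
  rewrite (_ : K * 2 * _ = \sum_(0 <= k < N) (K * th ^+ N * 2)).
    apply: ler_sum_nat => k /andP[_ kN].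
    by rewrite -[X in th ^+ X](subnKC (ltnW kN)); exact: tail.
  by rewrite sumr_const_nat subn0 -[RHS]mulr_natr; ring.
rewrite -(add0r l); apply: (cvgC_ext _ (cvgCD hdv dl)) => N /=.
by rewrite -[RHS](subrK (series d N)).
Qed.

End ComplexSeries.

(** * The complex binomial series *)

Section ComplexCurves.
Variable R : realType.
Local Notation C := R[i].
Implicit Types (f g : R -> C) (t : R) (d : C).

Lemma is_derive_eqfun (h k : R -> R) t (d e : R) :
  h =1 k -> d = e -> is_derive t (1 : R) h d -> is_derive t (1 : R) k e.
Proof. by move=> /funext -> ->. Qed.

Lemma is_derive_add (h k : R -> R) t (d e : R) :
  is_derive t (1 : R) h d -> is_derive t (1 : R) k e ->
  is_derive t (1 : R) (fun x => h x + k x) (d + e).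
Proof. exact: is_deriveD. Qed.

Lemma is_derive_mul (h k : R -> R) t (d e : R) :
  is_derive t (1 : R) h d -> is_derive t (1 : R) k e ->
  is_derive t (1 : R) (fun x => h x * k x) (d * k t + h t * e).
Proof.
move=> hd ke; apply: is_derive_eqfun (is_deriveM hd ke) => //=.
by rewrite -![_ *: _]/(_ * _) addrC [k t * d]mulrC.
Qed.

Lemma is_derive_sub (h k : R -> R) t (d e : R) :
  is_derive t (1 : R) h d -> is_derive t (1 : R) k e ->
  is_derive t (1 : R) (fun x => h x - k x) (d - e).
Proof.
by move=> hd ke; apply: is_derive_add.
Qed.

(** Curves from R to C are differentiated componentwise, so that real calculus, in particular the
    mean value theorem, applies. *)
Definition is_curve_derive f t d :=
  is_derive t (1 : R) (fun x => complex.Re (f x)) (complex.Re d) /\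
  is_derive t (1 : R) (fun x => complex.Im (f x)) (complex.Im d).

Lemma ReM (z w : C) : complex.Re (z * w) =
  complex.Re z * complex.Re w - complex.Im z * complex.Im w.
Proof. by case: z; case: w. Qed.

Lemma ImM (z w : C) : complex.Im (z * w) =
  complex.Re z * complex.Im w + complex.Im z * complex.Re w.
Proof. by case: z; case: w. Qed.

Lemma is_curve_deriveM f g t d e : is_curve_derive f t d ->
  is_curve_derive g t e ->
  is_curve_derive (fun x => f x * g x) t (d * g t + f t * e).
Proof.
move=> [fR fI] [gR gI]; split.
  apply: (is_derive_eqfun (fun x => esym (ReM (f x) (g x))) _
    (is_derive_sub (is_derive_mul fR gR) (is_derive_mul fI gI))).
  by case: d {fR fI} => ? ?; case: e {gR gI} => ? ?; case: (f t) => ? ?;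
     case: (g t) => ? ? /=; ring.
apply: (is_derive_eqfun (fun x => esym (ImM (f x) (g x))) _
  (is_derive_add (is_derive_mul fR gI) (is_derive_mul fI gR))).
by case: d {fR fI} => ? ?; case: e {gR gI} => ? ?; case: (f t) => ? ?;
   case: (g t) => ? ? /=; ring.
Qed.

Lemma is_curve_derive_cst (z : C) t : is_curve_derive (fun=> z) t 0.
Proof. by split; exact: is_derive_cst. Qed.

Lemma is_curve_derive_cexp f t d : is_curve_derive f t d ->
  is_curve_derive (fun x => cexp (f x)) t (cexp (f t) * d).
Proof.
move=> [fR fI].
have hE := is_derive1_comp (is_derive_expR _) fR.
have hc := is_derive1_comp (is_derive_cos _) fI.
have hs := is_derive1_comp (is_derive_sin _) fI.
split.
  apply: (is_derive_eqfun _ _ (is_derive_mul hE hc)).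
    by move=> x /=; case: (f x).
  by rewrite /=; case: (f t) => x y; case: d {fR fI hE hc hs} => ? ? /=; ring.
apply: (is_derive_eqfun _ _ (is_derive_mul hE hs)).
  by move=> x /=; case: (f x).
by rewrite /=; case: (f t) => x y; case: d {fR fI hE hc hs} => ? ? /=; ring.
Qed.

Lemma cexpD (z w : C) : cexp (z + w) = cexp z * cexp w.
Proof.
case: z => x y; case: w => u v.
by apply/eqP; rewrite eq_complex /= expRD cosD sinD; apply/andP; split;
  apply/eqP; ring.
Qed.

Lemma cexp0 : cexp 0 = 1 :> C.
Proof. by apply/eqP; rewrite eq_complex /= expR0 cos0 sin0 mulr1 mulr0 !eqxx. Qed.

Lemma curve_derive0_eq f : (forall t, 0 <= t <= 1 -> is_curve_derive f t 0) ->
  f 0 = f 1.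
Proof.
move=> hf.
have cst (h : R -> R) : (forall t, 0 <= t <= 1 -> is_derive t (1 : R) h 0) ->
    h 0 = h 1.
  move=> hh.
  have [| | |c _] := @MVT_segment R h (fun=> 0) 0 1.
  exact: ler01.
  by move=> x; rewrite in_itv /= => /andP[x0 x1]; apply: hh; rewrite !ltW.
  apply: derivable_within_continuous => x; rewrite in_itv /= => hx.
  by have [] := hh x hx.
  rewrite mul0r => /eqP; rewrite subr_eq0 eq_sym; exact: eqP.
have hR := cst _ (fun t ht => (hf t ht).1).
have hI := cst _ (fun t ht => (hf t ht).2).
by move: hR hI; case: (f 0) => ? ?; case: (f 1) => ? ? /= -> ->.
Qed.

(** Logarithm on the right half-plane. With [atan] it is given by one differentiable formula across
    the real axis, where [carg] switches between two. *)
Definition rlog (z : C) : C :=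
  let: Complex x y := z in Complex (ln (x ^+ 2 + y ^+ 2) / 2) (atan (y / x)).

(** For x > 0, cos(atan(y / x)) = x / |z|, so [acos] recovers the angle up to sign, and the sign of
    y decides. *)
Lemma clog_rlog (z : C) : 0 < complex.Re z -> clog z = rlog z.
Proof.
case: z => x y /= x0.
have q0 : 0 < x ^+ 2 + y ^+ 2 by rewrite ltr_pwDl ?exprn_gt0 ?sqr_ge0.
congr Complex.
  rewrite -[in RHS](sqr_sqrtr (ltW q0)) lnXn ?sqrtr_gt0// mulr2n.
  by field.
have e : x / Num.sqrt (x ^+ 2 + y ^+ 2) = cos (atan (y / x)).
  rewrite cos_atan.
  have -> : 1 + (y / x) ^+ 2 = (x ^+ 2 + y ^+ 2) / x ^+ 2.
    by field; rewrite gt_eqF.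
  rewrite sqrtrM ?(ltW q0)// -exprVn sqrtr_sqr ger0_norm ?invr_ge0 ?(ltW x0)//.
  by rewrite invfM invrK mulrC.
rewrite e; have b1 := atan_gtNpi2 (y / x); have b2 := atan_ltpi2 (y / x).
have pi0 := pi_gt0 R; case: ifPn => y0.
  have a0 : 0 <= atan (y / x) by rewrite -atan0 le_atan// divr_ge0// ltW.
  by rewrite cosK// in_itv /=; apply/andP; split; lra.
have a0 : atan (y / x) <= 0.
  by rewrite -atan0 le_atan// pmulr_lle0 ?invr_gt0// ltW// ltNge.
by rewrite cosKN ?opprK//; apply/andP; split; lra.
Qed.

Lemma is_curve_derive_rlog f t d : 0 < complex.Re (f t) ->
  is_curve_derive f t d -> is_curve_derive (fun x => rlog (f x)) t (d / f t).
Proof.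
move=> f0 [fR fI]; have fR0 : complex.Re (f t) != 0 by rewrite gt_eqF.
have q0 : 0 < complex.Re (f t) * complex.Re (f t) +
              complex.Im (f t) * complex.Im (f t).
  by rewrite ltr_pwDl ?mulr_gt0// -expr2 sqr_ge0.
have hq := is_derive_add (is_derive_mul fR fR) (is_derive_mul fI fI).
pose q x := complex.Re (f x) * complex.Re (f x) +
            complex.Im (f x) * complex.Im (f x).
have hl := @is_derive1_comp R _ q t _ _ (is_derive1_ln q0) hq.
have hV := is_derive_mul fI (is_deriveV fR0 fR).
have ha := is_derive1_comp (is_derive1_atan _) hV.
split.
  apply: (is_derive_eqfun _ _ (is_derive_mul hl (is_derive_cst (2^-1 : R) t (1 : R)))).
    by move=> x /=; rewrite /q; case: (f x) => ? ? /=; rewrite -!expr2.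
  move: q0 fR0; rewrite /=; case: (f t) => x y /= q0 x0.
  by case: d {fR fI hq hl hV ha} => u v /=; field; rewrite -!expr2 in q0 *; rewrite gt_eqF.
apply: (is_derive_eqfun _ _ ha).
  by move=> x /=; case: (f x).
move: q0 fR0; rewrite /=; case: (f t) => x y /= q0 x0.
case: d {fR fI hq hl hV ha} => u v /=; rewrite -[_ *: _]/(_ * _).
by field; rewrite -!expr2 in q0 *; rewrite gt_eqF//= x0.
Qed.

End ComplexCurves.

(** * Rising factorials and the sum of the binomial series *)

Section BinomialSeries.
Variable R : realType.
Local Notation C := R[i].
Implicit Types (b s z : C) (u : nat -> C) (K th t : R).

(** Coefficient of s^j in (1 - s)^(-b). *)
Definition rising_coef b (j : nat) : C := poch b j / j`!%:R.

Lemma poch0 b : poch b 0 = 1.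
Proof. by rewrite /poch big_ord0. Qed.

Lemma pochS b j : poch b j.+1 = poch b j * (b + j%:R).
Proof. by rewrite /poch big_ord_recr. Qed.

Lemma pochSl b j : poch b j.+1 = b * poch (b + 1) j.
Proof.
rewrite /poch big_ord_recl addr0; congr (_ * _).
by apply: eq_bigr => i _; rewrite lift0 -nat1r addrA.
Qed.

Lemma pochD b m j : poch b (m + j) = poch b m * poch (b + m%:R) j.
Proof.
elim: j => [|j IH]; first by rewrite addn0 poch0 mulr1.
by rewrite addnS !pochS IH natrD; ring.
Qed.

Lemma poch_neq0 b j : (forall m, (m < j)%N -> b != - m%:R) -> poch b j != 0.
Proof.
move=> hb; apply/prodf_neq0 => i _; rewrite -[i%:R]opprK subr_eq0.
exact: hb.
Qed.

Lemma natr_fact_neq0 j : j`!%:R != 0 :> C.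
Proof. by rewrite pnatr_eq0 -lt0n fact_gt0. Qed.

Lemma poch1 j : poch 1 j = j`!%:R :> C.
Proof.
elim: j => [|j IH]; first by rewrite poch0.
by rewrite pochS IH factS natrM mulrC nat1r.
Qed.

Lemma rising_coef0 b : rising_coef b 0 = 1.
Proof. by rewrite /rising_coef poch0 divr1. Qed.

Lemma rising_coefS b j :
  j.+1%:R * rising_coef b j.+1 = (b + j%:R) * rising_coef b j.
Proof.
rewrite /rising_coef pochS factS natrM.
by field; rewrite natr_fact_neq0 nat1r pnatr_eq0.
Qed.

Lemma bin_le_exp2 n m : ('C(n, m) <= 2 ^ n)%N.
Proof.
elim: n m => [|n IH] [|m]; rewrite ?bin0 ?expn_gt0//.
by rewrite binS expnS mul2n -addnn leq_add.
Qed.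

(** By induction from [rising_coefS]: |b + j| <= N + j + 1, and C(N + j, j) obeys the same
    recurrence with N + j + 1 in place of b + j. *)
Lemma normc_rising_coef b (N j : nat) : normc b <= N%:R ->
  normc (rising_coef b j) <= 2 ^+ (N + j).
Proof.
move=> bN; suff h : normc (rising_coef b j) <= 'C(N + j, j)%:R.
  by rewrite (le_trans h)// -natrX ler_nat bin_le_exp2.
elim: j => [|j IH]; first by rewrite rising_coef0 normc1 bin0.
rewrite -(@ler_pM2l _ j.+1%:R)// -{1}(normc_nat R j.+1) -normcM rising_coefS.
rewrite normcM addnS -natrM -mul_bin_diag /= natrM.
apply: ler_pM IH; rewrite ?normc_ge0// (le_trans (le_normcD _ _))//.
by rewrite normc_nat -natr1 natrD -addrA lerD// lerDl.
Qed.

Lemma normc_nat_bound b : exists N : nat, normc b <= N%:R.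
Proof.
by exists (Num.bound (normc b)); rewrite ltW// archi_boundP// normc_ge0.
Qed.

(** The factor j + 1 brought by differentiation is absorbed by doubling the ratio. *)
Lemma pseries_diffs_dominated (c : nat -> R) K th : 0 <= K -> 0 <= th ->
  (forall j, `|c j| <= K * th ^+ j) ->
  forall j, `|pseries_diffs c j| <= (K * (2 * th)) * (2 * th) ^+ j.
Proof.
move=> K0 th0 hc j; rewrite /pseries_diffs normrM ger0_norm//.
rewrite -mulrA -exprS exprMn mulrCA ler_pM//.
by rewrite -natrX ler_nat ltnW// ltn_expl.
Qed.

Lemma pseries_dominated (c : nat -> R) K th x : 0 <= K -> 0 <= th -> 0 <= x ->
  x * th < 1 -> (forall j, `|c j| <= K * th ^+ j) -> cvgn (pseries c x).
Proof.
move=> K0 th0 x0 xth hc; apply: normed_cvg; rewrite /normed_series_of /=.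
apply: (@series_le_cvg _ _ (geometric K (x * th))) => [n//|n|n|] /=.
- by rewrite mulr_ge0 ?exprn_ge0 ?mulr_ge0.
- rewrite normrM normrX (ger0_norm x0) exprMn mulrCA mulrC.
  by rewrite ler_wpM2l ?exprn_ge0.
- by apply: is_cvg_geometric_series; rewrite ger0_norm ?mulr_ge0.
Qed.

Lemma pseries_derive_dominated (c : nat -> R) K th t : 0 <= K ->
  0 <= th <= 16^-1 -> (forall j, `|c j| <= K * th ^+ j) -> 0 <= t <= 1 ->
  is_derive t (1 : R) (fun x => limn (pseries c x))
    (limn (pseries (pseries_diffs c) t)).
Proof.
move=> K0 /andP[th0 th1] hc /andP[t0 t1].
have hc1 := pseries_diffs_dominated K0 th0 hc.
have hc2 := pseries_diffs_dominated (mulr_ge0 K0 (mulr_ge0 (ler0n _ 2) th0))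
  (mulr_ge0 (ler0n _ 2) th0) hc1.
(* Termwise differentiation is justified inside radius 2: the coefficients and their two formal
   derivatives have ratios th, 2 th and 4 th, and twice the last is at most 1/2. *)
apply: (@pseries_snd_diffs _ _ 2); last by rewrite !ger0_norm//; lra.
- by apply: (pseries_dominated _ _ _ _ hc) => //; lra.
- by apply: (pseries_dominated _ _ _ _ hc1) => //; try lra; rewrite !mulr_ge0.
- by apply: (pseries_dominated _ _ _ _ hc2) => //; try lra; rewrite !mulr_ge0// mulr_ge0.
Qed.

(** The sum of u_j x^j for real x, built from two real power series because those can be
    differentiated termwise. *)
Definition real_series u (x : R) : C :=
  Complex (limn (pseries (fun j => complex.Re (u j)) x))
          (limn (pseries (fun j => complex.Im (u j)) x)).

Lemma Re_mul_real z (x : R) : complex.Re (z * real_complex R x) = complex.Re z * x.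
Proof. by case: z => a b /=; ring. Qed.

Lemma Im_mul_real z (x : R) : complex.Im (z * real_complex R x) = complex.Im z * x.
Proof. by case: z => a b /=; ring. Qed.

Lemma cvg_real_series u K th t : 0 <= K -> 0 <= th < 1 ->
  (forall j, normc (u j) <= K * th ^+ j) -> 0 <= t <= 1 ->
  series (fun j => u j * real_complex R t ^+ j) @ \oo --> real_series u t.
Proof.
move=> K0 /andP[th0 th1] hu /andP[t0 t1].
have tth : t * th < 1 by rewrite (le_lt_trans _ th1)// ler_piMl.
apply: cvgC_ReIm => /=.
  rewrite (_ : (fun n => _) = pseries (fun j => complex.Re (u j)) t).
    apply: (pseries_dominated K0 th0 t0 tth) => j.
    by apply: (le_trans (abs_Re_le_normc (u j))); exact: hu.
  apply/funext => n; rewrite Re_series; congr series; apply/funext => j.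
  by rewrite -rmorphXn Re_mul_real.
rewrite (_ : (fun n => _) = pseries (fun j => complex.Im (u j)) t).
  apply: (pseries_dominated K0 th0 t0 tth) => j.
  by apply: (le_trans (abs_Im_le_normc (u j))); exact: hu.
apply/funext => n; rewrite Im_series; congr series; apply/funext => j.
by rewrite -rmorphXn Im_mul_real.
Qed.

Lemma real_series_derive u K th t : 0 <= K -> 0 <= th <= 16^-1 ->
  (forall j, normc (u j) <= K * th ^+ j) -> 0 <= t <= 1 ->
  is_curve_derive (real_series u) t
    (real_series (fun j => j.+1%:R * u j.+1) t).
Proof.
move=> K0 thb hu tb; rewrite /real_series; split.
  rewrite [complex.Re _]/= (_ : (fun j => complex.Re (j.+1%:R * _)) =
    pseries_diffs (fun j => complex.Re (u j))).
    apply: (pseries_derive_dominated K0 thb _ tb) => j.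
    by apply: (le_trans (abs_Re_le_normc (u j))); exact: hu.
  apply/funext => j; rewrite /pseries_diffs mulrC -(rmorph_nat (real_complex R)).
  by rewrite Re_mul_real mulrC.
rewrite [complex.Im _]/= (_ : (fun j => complex.Im (j.+1%:R * _)) =
  pseries_diffs (fun j => complex.Im (u j))).
  apply: (pseries_derive_dominated K0 thb _ tb) => j.
  by apply: (le_trans (abs_Im_le_normc (u j))); exact: hu.
apply/funext => j; rewrite /pseries_diffs mulrC -(rmorph_nat (real_complex R)).
by rewrite Im_mul_real mulrC.
Qed.

Lemma normc_binomial_term b s (N : nat) (th : R) : normc b <= N%:R ->
  2 * normc s <= th ->
  forall j, normc (rising_coef b j * s ^+ j) <= 2 ^+ N * th ^+ j.
Proof.
move=> bN hs j; rewrite normcM normcX.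
rewrite (le_trans (ler_wpM2r (exprn_ge0 _ (normc_ge0 _)) (normc_rising_coef _ bN)))//.
rewrite exprD -mulrA -exprMn ler_wpM2l ?exprn_ge0// lerXn2r ?nnegrE//.
  by rewrite mulr_ge0 ?normc_ge0.
by rewrite (le_trans _ hs)// mulr_ge0 ?normc_ge0.
Qed.

Lemma Re_1B_gt0 z : normc z < 1 -> 0 < complex.Re (1 - z).
Proof.
move=> z1; rewrite ReB subr_gt0 (le_lt_trans (ler_norm _))//.
by rewrite (le_lt_trans (abs_Re_le_normc _)).
Qed.

Lemma neq0_Re z : 0 < complex.Re z -> z != 0.
Proof. by apply: contraTneq => ->; rewrite ltxx. Qed.

(* Both sides solve the same first order equation along the segment from [0]
   to [s]: [(1 - t s) g' = b s g]. *)
Lemma binomial_series_cvg b s : normc s <= 32^-1 ->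
  series (fun j => rising_coef b j * s ^+ j) @ \oo --> cpow (1 - s) (- b).
Proof.
move=> hs; have [N bN] := normc_nat_bound b.
pose u j := rising_coef b j * s ^+ j.
(* The bound 1/32 on |s| gives the ratio 2 |s| <= 1/16 that termwise differentiation requires. *)
have hu : forall j, normc (u j) <= 2 ^+ N * 16^-1 ^+ j.
  by apply: normc_binomial_term bN _; lra.
have K0 : 0 <= 2 ^+ N :> R by exact: exprn_ge0.
have thb : 0 <= (16^-1 : R) <= 16^-1 by apply/andP; split; lra.
have th1 : 0 <= (16^-1 : R) < 1 by apply/andP; split; lra.
pose g := real_series u.
pose w (t : R) : C := 1 - s * real_complex R t.
have w_small t : 0 <= t <= 1 -> 0 < complex.Re (w t).
  move=> /andP[t0 t1]; apply: Re_1B_gt0; rewrite normcM normc_real ger0_norm//.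
  rewrite (@le_lt_trans _ _ (32^-1))//; last by lra.
  by rewrite (le_trans _ hs)// ler_piMr ?normc_ge0.
have w0 t tb := neq0_Re (w_small t tb).
have wd t : is_curve_derive w t (- s).
  have hid : is_derive t (1 : R) (fun x : R => x) 1 by exact: is_derive_id.
  split.
    apply: (is_derive_eqfun _ _ (is_derive_sub (is_derive_cst (1 : R) t (1 : R))
      (is_derive_mul (is_derive_cst (complex.Re s) t (1 : R)) hid))).
      by move=> x; rewrite /w ReB Re_mul_real.
    by case: (s) => x y /=; ring.
  apply: (is_derive_eqfun _ _ (is_derive_sub (is_derive_cst (0 : R) t (1 : R))
    (is_derive_mul (is_derive_cst (complex.Im s) t (1 : R)) hid))).
    by move=> x; rewrite /w ImB Im_mul_real.
  by case: (s) => x y /=; ring.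
have g_cvg t tb := cvg_real_series K0 th1 hu tb : _ @ \oo --> g t.
have ode t : 0 <= t <= 1 -> 
    w t * real_series (fun j => j.+1%:R * u j.+1) t = b * s * g t.
  move=> tb; set g' := real_series _ t.
  have g'_cvg : series (fun j => j.+1%:R * u j.+1 * real_complex R t ^+ j) @ \oo --> g'.
    apply: (@cvg_real_series _ (2 ^+ N * (2 / 16)) (2 / 16)) => //.
    + by apply/andP; split; lra.
    + move=> j; rewrite normcM normc_nat -mulrA -exprS exprMn.
      rewrite (le_trans (ler_wpM2l (ler0n _ _) (hu j.+1)))// mulrCA.
      rewrite ler_wpM2l// ler_wpM2r ?exprn_ge0//.
      by rewrite -natrX ler_nat ltnW// ltn_expl.
  (* The partial sums satisfy the equation up to one boundary term, which tends to 0. *)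
  have key n : w t * series (fun j => j.+1%:R * u j.+1 * real_complex R t ^+ j) n -
      b * s * series (fun j => u j * real_complex R t ^+ j) n =
      - (s * n%:R * u n * real_complex R t ^+ n).
    elim: n => [|n IH].
      by rewrite /series /= !big_nil; ring.
    have un : n.+1%:R * u n.+1 = (b + n%:R) * s * u n.
      by rewrite /u exprS mulrA rising_coefS; ring.
    rewrite !seriesSr !mulrDr opprD addrACA IH -[s * n.+1%:R * _]mulrA un /w exprS.
    by ring.
  apply/eqP; rewrite -subr_eq0; apply/eqP.
  have h1 := cvgCB (cvgCZ (z := w t) g'_cvg) (cvgCZ (z := b * s) (g_cvg t tb)).
  apply: (cvgC_unique h1).
  apply: (cvgC_le _ (@cvg_expr_mulrn _ (2 ^+ N) 16^-1 _ _)); try lra.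
  move=> n; rewrite sub0r normcN.
  rewrite [X in normc X](key n).
  rewrite normcN 3!normcM [normc (_ ^+ n)]normcX normc_nat normc_real.
  rewrite [leRHS]mulrCA [leLHS](_ : _ =
    n%:R * (normc (u n) * (normc s * `|t| ^+ n))); last by ring.
  rewrite ler_wpM2l// (le_trans _ (hu n))// ler_piMr ?normc_ge0//.
  case/andP: tb => t0 t1; rewrite mulr_ile1 ?normc_ge0 ?exprn_ge0//.
    by rewrite (le_trans hs)//; lra.
  by rewrite ger0_norm// exprn_ile1.
(* Integrating factor (1 - t s)^b: its product with [g] is constant on [0, 1]. *)
pose phi t := cexp (b * rlog (w t)).
have d0 t : 0 <= t <= 1 -> is_curve_derive (fun x => phi x * g x) t 0.
  move=> tb; have hphi := is_curve_derive_cexp (is_curve_deriveM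
    (is_curve_derive_cst b t) (is_curve_derive_rlog (w_small t tb) (wd t))).
  have := is_curve_deriveM hphi (real_series_derive K0 thb hu tb).
  set d := (X in is_curve_derive _ _ X -> _) => hd; suff <- : d = 0 by [].
  rewrite /d; have := ode t tb; set g' := real_series _ t => odet.
  apply: (mulfI (w0 t tb)); rewrite mulr0 mulrDr [w t * (_ * g')]mulrCA odet.
  by rewrite -/(phi t) -/(g t); field; exact: w0.
have := curve_derive0_eq d0.
have g0 : g 0 = 1.
  have le01 : 0 <= (0 : R) <= 1 by rewrite lexx ler01.
  apply: (cvgC_unique (g_cvg _ le01)).
  (* At t = 0 every partial sum is 1 except the empty one, whose error 1 is the first term of the
     bound 2^(-n). *)
  have geo : geometric 1 2^-1 @ \oo --> (0 : R).
    by apply: cvg_geometric; rewrite ger0_norm; lra.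
  apply: (cvgC_le _ geo) => -[|n].
    by rewrite /series /= big_nil subr0 normc1 expr0 mulr1.
  rewrite /series /= big_nat_recl// big1 => [|i _].
    by rewrite /u rising_coef0 !expr0 !mulr1 addr0 subrr normc0 mul1r exprn_ge0.
  by rewrite (rmorph0 (real_complex R)) expr0n mulr0.
have w00 : w 0 = 1 by rewrite /w (rmorph0 (real_complex R)) mulr0 subr0.
have w01 : w 1 = 1 - s by rewrite /w (rmorph1 (real_complex R)) mulr1.
have log1 : rlog (1 : C) = 0.
  by rewrite /rlog /= expr1n expr0n addr0 ln1 !mul0r atan0.
rewrite g0 /phi w00 w01 log1 mulr0 cexp0 mulr1.
rewrite -clog_rlog; last by rewrite -w01; apply: w_small; rewrite ler01 lexx.
move=> e.
have -> : cpow (1 - s) (- b) = g 1.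
  have E : cexp (- (b * clog (1 - s))) * (cexp (b * clog (1 - s)) * g 1) = g 1.
    by rewrite mulrA -cexpD addNr cexp0 mul1r.
  by rewrite -E -e mulr1 /cpow mulNr.
have le11 : 0 <= (1 : R) <= 1 by rewrite lexx ler01.
apply: cvgC_ext (g_cvg _ le11) => n; congr series; apply/funext => j.
by rewrite (rmorph1 (real_complex R)) expr1n mulr1.
Qed.

End BinomialSeries.

(** * Expansion in powers of s *)

Section PowerExpansion.
Variable R : realType.
Local Notation C := R[i].
Implicit Types (a b s x : C) (D h : nat -> C).

Lemma cvg_series_finite D N : (forall r, (N <= r)%N -> D r = 0) ->
  series D @ \oo --> series D N.
Proof.
move=> h; apply/cvgC_normc; apply/cvgrPdist_lt => e e0; exists N => // n Nn.
rewrite sub0r normrN normcB sub_series_geq// big_nat_cond big1 ?normc0 ?normr0//.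
by move=> i /andP[/andP[Ni _] _]; exact: h.
Qed.

Lemma cpowD z a b : cpow z (a + b) = cpow z a * cpow z b :> C.
Proof. by rewrite /cpow mulrDl cexpD. Qed.

Lemma cpow0 z : cpow z 0 = 1 :> C.
Proof. by rewrite /cpow mul0r cexp0. Qed.

Lemma cpowNr z a : cpow z a * cpow z (- a) = 1 :> C.
Proof. by rewrite -cpowD subrr cpow0. Qed.

(** The binomial series for b = -1 stops after two terms, which gives the exponent 1; the other
    exponents follow by additivity. *)
Lemma cpow_nat s n : normc s <= 32^-1 -> cpow (1 - s) n%:R = (1 - s) ^+ n.
Proof.
move=> hs; have c1 : cpow (1 - s) 1 = 1 - s.
  rewrite -[X in cpow _ X]opprK; apply: cvgC_unique (binomial_series_cvg hs) _.
  have := @cvg_series_finite (fun j => rising_coef (-1) j * s ^+ j) 2.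
  rewrite {2}/series /= big_nat_recr//= big_nat1 rising_coef0 expr0 mulr1.
  rewrite (_ : rising_coef _ 1 = -1); last first.
    by rewrite /rising_coef pochS poch0 addr0 mul1r divr1.
  rewrite mulN1r; apply=> -[|[|r]] // _.
  by rewrite /rising_coef -[r.+2]add2n pochD !pochS addNr mulr0 !mul0r.
elim: n => [|n IH]; first by rewrite cpow0 expr0.
by rewrite -natr1 cpowD IH c1 exprSr.
Qed.

(** For k > N >= |b| the modulus is at least 1; finitely many nonzero values remain, over which a
    minimum is taken. *)
Lemma lower_ok_gap b : (forall m : nat, b != - m%:R) ->
  exists2 d : R, 0 < d & forall k, d <= normc (b + k%:R).
Proof.
move=> hb; have [N bN] := normc_nat_bound b.
have pos k : 0 < normc (b + k%:R).
  rewrite lt_neqAle normc_ge0 andbT eq_sym; apply: contra (hb k) => /eqP h0.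
  by rewrite -subr_eq0 opprK (eq0_normc h0).
suff [d d0 hd] : exists2 d : R, 0 < d & forall k, (k < N.+1)%N -> d <= normc (b + k%:R).
  exists (Num.min d 1); first by rewrite lt_min d0 ltr01.
  move=> k; have [kN|Nk] := ltnP k N.+1; first by rewrite ge_min hd.
  rewrite ge_min; apply/orP; right.
  have : normc (k%:R : C) <= normc (b + k%:R) + normc b.
    by have := le_normcD (b + k%:R) (- b); rewrite normcN addrAC subrr add0r.
  rewrite normc_nat; have : N.+1%:R <= k%:R :> R by rewrite ler_nat.
  by rewrite -natr1; lra.
elim: N.+1 => [|n [d d0 hd]]; first by exists 1.
exists (Num.min d (normc (b + n%:R))); first by rewrite lt_min d0 pos.
move=> k; rewrite ltnS leq_eqVlt => /predU1P[->|kn].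
  by rewrite ge_min lexx orbT.
by rewrite ge_min hd.
Qed.

(** Factor by factor, |a + k| <= |b + k| + |a - b| <= (1 + |a - b| / d) |b + k|. *)
Lemma poch_ratio_bound a b : (forall m : nat, b != - m%:R) ->
  exists2 M : R, 0 <= M & forall k, normc (poch a k) <= M ^+ k * normc (poch b k).
Proof.
move=> /lower_ok_gap[d d0 hd].
have M0 : 0 <= 1 + normc (a - b) / d.
  by rewrite addr_ge0// divr_ge0 ?normc_ge0// ltW.
exists (1 + normc (a - b) / d) => //.
elim=> [|k IH]; first by rewrite !poch0 mul1r.
rewrite !pochS !normcM exprSr mulrACA ler_pM ?normc_ge0//.
have -> : a + k%:R = (b + k%:R) + (a - b) by ring.
rewrite (le_trans (le_normcD _ _))// mulrDl mul1r lerD2l mulrAC.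
by rewrite ler_pdivlMr// ler_wpM2l ?normc_ge0.
Qed.

Lemma prod_poch_ratio_bound (al be : seq C) : size al = size be ->
  lower_ok be -> exists2 M : R, 0 <= M & forall k,
    normc (\prod_(a <- al) poch a k) <= M ^+ k * normc (\prod_(b <- be) poch b k).
Proof.
elim: al be => [|a al IH] [|b be]//= => [_ _|[sab] hbe].
  by exists 1 => // k; rewrite !big_nil expr1n mul1r.
have [||M M0 hM] := IH be; first exact: sab.
  by move=> x xb; apply: hbe; rewrite inE xb orbT.
have [|M' M0' hM'] := @poch_ratio_bound a b.
  by apply: hbe; rewrite inE eqxx.
exists (M' * M) => [|k]; first exact: mulr_ge0.
by rewrite !big_cons !normcM exprMn mulrACA ler_pM ?normc_ge0.
Qed.

Definition hyp_coef (al be : seq C) (k : nat) : C :=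
  \prod_(a <- al) poch a k / (\prod_(b <- be) poch b k * poch 1 k).

(** Here k! = (1)_k counts as one more lower parameter, so the two lists pair off and the ratio
    bound applies. *)
Lemma hyp_coef_bound (al be : seq C) : size al = (size be).+1 ->
  lower_ok be -> exists2 M : R, 0 <= M & forall k, normc (hyp_coef al be k) <= M ^+ k.
Proof.
move=> sab hbe; have [||M M0 hM] := @prod_poch_ratio_bound al (1 :: be).
- by [].
- move=> b; rewrite inE => /predU1P[->|/hbe//] m.
  by rewrite -subr_eq0 opprK nat1r pnatr_eq0.
exists M => // k; rewrite /hyp_coef normcM normcV ler_pdivrMr.
  by rewrite [_ * poch 1 k]mulrC; have := hM k; rewrite big_cons.
rewrite lt_neqAle normc_ge0 andbT eq_sym; apply/eqP => /eq0_normc/eqP.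
rewrite mulf_eq0 poch1 (negbTE (natr_fact_neq0 _ _)) orbF.
rewrite prodf_seq_eq0 => /hasP[b bbe /=]; apply/negP.
by apply: poch_neq0 => m _; exact: hbe.
Qed.

(* Coefficients in [s] of [sum_k h_k (kappa s / (1-s)^n)^k (1-s)^(-a)]. *)
Definition expansion_coef h (kappa a : C) (n r : nat) : C :=
  \sum_(0 <= k < r.+1) h k * kappa ^+ k * rising_coef (a + (n * k)%:R) (r - k).

(** Each power (1 - s)^(-(a + nk)) is expanded by the binomial series, and the resulting double
    series is summed by diagonals. *)
Lemma power_expansion h kappa a n (M : R) : 0 <= M ->
  (forall k, normc (h k) <= M ^+ k) ->
  exists2 d : R, 0 < d & forall s, normc s <= d -> exists l,
    series (fun k => h k * (kappa * (s / (1 - s) ^+ n)) ^+ k) @ \oo -->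
      cpow (1 - s) a * l /\
    series (fun r => expansion_coef h kappa a n r * s ^+ r) @ \oo --> l.
Proof.
move=> M0 hM; have [N aN] := normc_nat_bound a.
(* The terms of the double series are bounded by 2^N (M |kappa| 2^n |s|)^k (2 |s|)^j, and [Q] |s|
   dominates both ratios. *)
pose Q := M * normc kappa * 2 ^+ n + 2.
have q0 : 0 <= M * normc kappa * 2 ^+ n by rewrite !mulr_ge0 ?exprn_ge0 ?normc_ge0.
have Q0 : 0 < Q by rewrite ltr_wpDl.
(* Since Q >= 2, this radius yields both Q |s| <= 1/32, hence a ratio below 1/2, and |s| <= 1/32 for
   the binomial series. *)
exists (32 * Q)^-1; first by rewrite invr_gt0 mulr_gt0.
move=> s hs.
have Qs : Q * normc s <= 32^-1.
  by rewrite -ler_pdivlMl// (le_trans hs)// invfM mulrC.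
have s32 : normc s <= 32^-1.
  rewrite (le_trans _ Qs)// ler_peMl ?normc_ge0// /Q.
  by have := q0; lra.
pose th := Q * normc s.
have th0 : 0 <= th by rewrite mulr_ge0 ?normc_ge0// ltW.
have th1 : th < 2^-1 by rewrite (le_lt_trans Qs)//; lra.
pose u k j := h k * kappa ^+ k * s ^+ k * (rising_coef (a + (n * k)%:R) j * s ^+ j).
have hu k j : normc (u k j) <= 2 ^+ N * th ^+ (k + j).
  have aNk : normc (a + (n * k)%:R) <= (N + n * k)%:R.
    by rewrite (le_trans (le_normcD _ _))// normc_nat natrD lerD2r.
  rewrite /u normcM [normc (h k * _ * _)]normcM [normc (h k * _)]normcM.
  rewrite [normc (rising_coef _ _ * _)]normcM !normcX.
  apply: (@le_trans _ _ (M ^+ k * normc kappa ^+ k * normc s ^+ k *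
     (2 ^+ (N + n * k + j) * normc s ^+ j))).
    rewrite ler_pM ?mulr_ge0 ?exprn_ge0 ?normc_ge0//.
      by rewrite !ler_wpM2r ?exprn_ge0 ?normc_ge0.
    by rewrite ler_wpM2r ?exprn_ge0 ?normc_ge0// normc_rising_coef.
  rewrite !exprD exprM.
  rewrite [leLHS](_ : _ = 2 ^+ N * ((M * normc kappa * 2 ^+ n * normc s) ^+ k *
     (2 * normc s) ^+ j)); last by rewrite !exprMn; ring.
  rewrite ler_wpM2l ?exprn_ge0// ler_pM ?exprn_ge0 ?mulr_ge0 ?exprn_ge0 ?normc_ge0//.
    rewrite lerXn2r ?nnegrE ?mulr_ge0 ?exprn_ge0 ?normc_ge0// ?(ltW Q0)//.
    by rewrite ler_wpM2r ?normc_ge0// lerDl.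
  rewrite lerXn2r ?nnegrE ?mulr_ge0 ?normc_ge0// ?(ltW Q0)//.
  by rewrite ler_wpM2r ?normc_ge0// lerDr.
pose v k := h k * kappa ^+ k * s ^+ k * cpow (1 - s) (- (a + (n * k)%:R)).
have hv k : series (u k) @ \oo --> v k.
  apply: cvgC_ext (cvgCZ (z := h k * kappa ^+ k * s ^+ k)
    (binomial_series_cvg (b := a + (n * k)%:R) s32)) => m.
  by rewrite /u /series /= mulr_sumr.
have [l [lv ld]] := double_series th0 th1 hu hv.
exists l; split.
  apply: cvgC_ext (cvgCZ (z := cpow (1 - s) a) lv) => m.
  rewrite /series /= mulr_sumr; apply: eq_bigr => k _.
  have e : cpow (1 - s) (- (n * k)%:R) = (((1 - s) ^+ n) ^+ k)^-1.
    have := cpowNr (1 - s) (n * k)%:R; rewrite cpow_nat// exprM => e1.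
    by rewrite (mulr1_eq e1).
  rewrite /v opprD cpowD e -[RHS]mul1r -[X in X * (h k * _)](cpowNr (1 - s) a).
  by rewrite !exprMn exprVn; ring.
apply: cvgC_ext ld => m; congr (series _ m); apply/funext => r.
rewrite /expansion_coef mulr_suml; apply: eq_big_nat => k /andP[_ kr].
have -> : s ^+ r = s ^+ k * s ^+ (r - k) by rewrite -exprD subnKC// ltnSE.
by rewrite /u; ring.
Qed.

(** Coefficients of the product of 1 + x s with the series of coefficients [D]. *)
Definition shift_add x D (r : nat) : C := D r + (if r is r'.+1 then x * D r' else 0).

Lemma shift_add_cvg x D s l : series (fun r => D r * s ^+ r) @ \oo --> l ->
  series (fun r => shift_add x D r * s ^+ r) @ \oo --> (1 + x * s) * l.
Proof.
move=> hD; rewrite -cvg_shiftS.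
have hD1 : (fun n => series (fun r => D r * s ^+ r) n.+1) @ \oo --> l.
  by rewrite cvg_shiftS.
rewrite mulrDl mul1r; apply: cvgC_ext (cvgCD hD1 (cvgCZ (z := x * s) hD)) => n.
rewrite /series /= big_nat_recl// [in RHS]big_nat_recl//=.
rewrite mulr_sumr -addrA -big_split /= /shift_add addr0; congr (_ + _).
by apply: eq_bigr => i _; rewrite exprS; ring.
Qed.

End PowerExpansion.

(** * Alternating binomial sums *)

Section AlternatingSums.
Variable R : realType.
Local Notation C := R[i].
Implicit Types (a b c e x : C) (g h : {poly C}) (f eps q : nat -> C).

(** Multiplication formula for rising factorials: raising k by one adds one factor per parameter,
    and together these are n consecutive factors, each divided by n. *)
Lemma prod_poch_arith a i n k : (0 < n)%N ->
  \prod_(x <- [seq (a + j%:R) / n%:R | j <- iota i n]) poch x k =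
  poch (a + i%:R) (n * k) / n%:R ^+ (n * k) :> C.
Proof.
move=> n0; have nN0 : n%:R != 0 :> C by rewrite pnatr_eq0 -lt0n.
rewrite big_map; elim: k => [|k IH].
  by rewrite big1 => [|x _]; rewrite ?muln0 ?poch0 ?divr1.
under eq_bigr do rewrite pochS.
rewrite big_split /= IH mulnS addnC pochD exprD invfM mulrACA; congr (_ * _).
transitivity (\prod_(x <- iota i n) ((a + (n * k)%:R + x%:R) / n%:R)).
  by apply: eq_bigr => j _; rewrite natrM; field.
rewrite big_split /=; congr (_ * _).
  rewrite -[in iota i n](addn0 i) iotaDl big_map.
  have -> : iota 0 n = index_iota 0 n by rewrite /index_iota subn0.
  rewrite big_mkord /poch.
  by apply: eq_bigr => j _; rewrite natrD; ring.
rewrite -exprVn; set z := n%:R^-1; elim: (n) (i) => [|m IHm] j; first by rewrite big_nil.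
by rewrite big_cons IHm exprS.
Qed.

(** Division by X - x that keeps track of the top coefficient. The last clause is conditional
    because for N = 0 the quotient is zero. *)
Lemma poly_div_linear g x N : (size g <= N.+1)%N -> exists h,
  [/\ g = h * ('X - x%:P) + (g.[x])%:P, (size h <= N)%N &
      forall M, N = M.+1 -> h`_M = g`_N].
Proof.
move=> sg; have /factor_theorem[h gh] : root (g - (g.[x])%:P) x.
  by rewrite /root !hornerE subrr.
have ge : g = h * ('X - x%:P) + (g.[x])%:P by rewrite -gh subrK.
have sh : (size h <= N)%N.
  have [->|h0] := eqVneq h 0; first by rewrite size_poly0.
  rewrite -ltnS (leq_trans _ sg)// ge size_polyDl.
    by rewrite size_Mmonic ?monicXsubC// size_XsubC addn2.
  rewrite size_Mmonic ?monicXsubC// size_XsubC addn2 (leq_ltn_trans (size_polyC_leq1 _))//.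
  by rewrite ltnS lt0n size_poly_eq0.
exists h; split=> // M NM.
rewrite {1}ge NM mulrBr coefD coefB coefMX coefMC coefC /= addr0.
by rewrite [h`_M.+1]nth_default ?mul0r ?subr0// -NM.
Qed.

(** This is (-1)^r times the r-th finite difference of f at 0. *)
Definition alt_sum (r : nat) f : C :=
  \sum_(0 <= k < r.+1) (-1) ^+ k * 'C(r, k)%:R * f k.

Lemma eq_alt_sum r f q : f =1 q -> alt_sum r f = alt_sum r q.
Proof. by move=> fq; apply: eq_bigr => k _; rewrite fq. Qed.

Lemma alt_sumD r f q : alt_sum r (fun k => f k + q k) = alt_sum r f + alt_sum r q.
Proof. by rewrite -big_split; apply: eq_bigr => k _; rewrite mulrDr. Qed.

Lemma alt_sumZ r c f : alt_sum r (fun k => c * f k) = c * alt_sum r f.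
Proof. by rewrite mulr_sumr; apply: eq_bigr => k _; rewrite mulrCA. Qed.

Lemma alt_sum_absorb r f :
  alt_sum r.+1 (fun k => k%:R * f k) = - r.+1%:R * alt_sum r (fun k => f k.+1).
Proof.
rewrite /alt_sum big_nat_recl// mul0r mulr0 add0r mulr_sumr.
apply: eq_bigr => k _; rewrite exprS !mulrA.
have e : r.+1%:R * 'C(r, k)%:R = k.+1%:R * 'C(r.+1, k.+1)%:R :> C.
  by rewrite -!natrM -mul_bin_diag.
congr (_ * _); transitivity (- (-1) ^+ k * (k.+1%:R * 'C(r.+1, k.+1)%:R) : C); first by ring.
by rewrite -e; ring.
Qed.

Lemma alt_sum_cst r c : alt_sum r.+1 (fun=> c) = 0.
Proof.
have := exprBn (1 : C) 1 r.+1; rewrite subrr expr0n /= => /esym e.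
rewrite /alt_sum -mulr_suml big_mkord.
rewrite (_ : \sum_(i < r.+2) _ = 0) ?mul0r// -[RHS]e.
by apply: eq_bigr => k _; rewrite !expr1n !mulr1 mulr_natr.
Qed.

(** Dividing g by X - b leaves a constant, which the sum kills, and a factor k, which lowers r by
    one and moves the base point to b + 1; hence the general [b]. *)
Lemma alt_sum_poly r g b : (size g <= r.+1)%N ->
  alt_sum r (fun k => g.[b + k%:R]) = (-1) ^+ r * r`!%:R * g`_r.
Proof.
elim: r g b => [|r IH] g b sg.
  rewrite /alt_sum big_nat1 bin0 addr0 !expr0 !mul1r.
  by rewrite [g in LHS]size1_polyC// hornerC.
have [h [ge sh hg]] := poly_div_linear b sg.
have e k : g.[b + k%:R] = k%:R * h.[b + k%:R] + g.[b].
  by rewrite {1}ge !hornerE; ring.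
rewrite (eq_alt_sum _ e) alt_sumD alt_sum_cst addr0 alt_sum_absorb.
rewrite (@eq_alt_sum _ _ (fun k => h.[b + 1 + k%:R])).
  by rewrite IH// (hg r)// factS natrM exprS; ring.
by move=> k; rewrite -nat1r addrA.
Qed.

Lemma alt_sum_poly0 r g : (size g <= r)%N -> alt_sum r (fun k => g.[k%:R]) = 0.
Proof.
move=> sg; rewrite (@eq_alt_sum _ _ (fun k => g.[0 + k%:R])).
  by rewrite alt_sum_poly ?(leq_trans sg)// nth_default ?mulr0.
by move=> k; rewrite add0r.
Qed.

Definition linear_prod c (F : nat -> C) (r : nat) : {poly C} :=
  \prod_(i < r) (c *: 'X + (F i)%:P).

Lemma linear_prodS c F r : linear_prod c F r.+1 =
  linear_prod c F r * (c *: 'X + (F r)%:P).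
Proof. by rewrite /linear_prod big_ord_recr. Qed.

Lemma size_linear_prod c F r : (size (linear_prod c F r) <= r.+1)%N.
Proof.
elim: r => [|r IH]; first by rewrite /linear_prod big_ord0 size_poly1.
rewrite linear_prodS (leq_trans (size_polyMleq _ _))//.
have s2 : (size (c *: 'X + (F r)%:P)%R <= 2)%N.
  rewrite (leq_trans (size_polyD _ _))// geq_max (leq_trans (size_scale_leq _ _)).
    by rewrite (leq_trans (size_polyC_leq1 _)).
  by rewrite size_polyX.
by rewrite -subn1 leq_subLR (leq_trans (leq_add IH s2))// addn2.
Qed.

Lemma coef_linear_prod c F r : (linear_prod c F r)`_r = c ^+ r.
Proof.
elim: r => [|r IH]; first by rewrite /linear_prod big_ord0 coef1.
rewrite linear_prodS mulrDr -scalerAr coefD coefZ coefMX coefMC /= IH.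
by rewrite nth_default ?size_linear_prod// mul0r addr0 exprS.
Qed.

Lemma horner_linear_prod c F r x :
  (linear_prod c F r).[x] = \prod_(i < r) (c * x + F i).
Proof.
by rewrite horner_prod; apply: eq_bigr => i _; rewrite !hornerE.
Qed.

Lemma poch_linear_prod a (p r k : nat) :
  poch (a + (p * k)%:R) r =
  (linear_prod p%:R (fun i => a + i%:R) r).[k%:R].
Proof.
by rewrite horner_linear_prod; apply: eq_bigr => i _; rewrite natrM; ring.
Qed.

(** * Alternating sums with the weight e / (e + k) *)

Section PartialFractions.
Variables (e : C) (eps : nat -> C).
(* [eps k] is [e / (e + k)], extended by [eps 0 = 1] when [e = 0]. *)
Hypothesis epsE : forall k, (e + k%:R) * eps k = e.
Hypothesis eps0 : eps 0%N = 1.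

(** Division of g by X + e: on the quotient part the weight cancels by [epsE] and a polynomial sum
    remains; the remainder g(-e) multiplies the sum of the weights. *)
Lemma alt_sum_eps_poly r g : (size g <= r.+2)%N ->
  alt_sum r (fun k => g.[k%:R] * eps k) =
  e * ((-1) ^+ r * r`!%:R * g`_r.+1) + g.[- e] * alt_sum r eps.
Proof.
move=> sg; have [h [ge sh hg]] := poly_div_linear (- e) sg.
have E k : g.[k%:R] * eps k = e * h.[0 + k%:R] + g.[- e] * eps k.
  rewrite {1}ge !hornerE mulrDl -mulrA opprK [_ + e]addrC epsE.
  by rewrite [_ * e]mulrC.
by rewrite (eq_alt_sum _ E) alt_sumD !alt_sumZ alt_sum_poly// (hg r).
Qed.

Lemma alt_sum_eps r : poch (e + 1) r != 0 ->
  alt_sum r eps = r`!%:R / poch (e + 1) r.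
Proof.
move=> p0.
(* [g] vanishes at 1, ..., r, so that only the term [k = 0] survives. *)
pose g := linear_prod (-1) (fun i => i.+1%:R) r.
have gE x : g.[x] = \prod_(i < r) (i.+1%:R - x).
  by rewrite horner_linear_prod; apply: eq_bigr => i _; rewrite mulN1r addrC.
have sg : (size g <= r.+1)%N := size_linear_prod _ _ _.
have ge : g.[- e] = poch (e + 1) r.
  by rewrite gE; apply: eq_bigr => i _; rewrite opprK -nat1r; ring.
have := @alt_sum_eps_poly r g (leq_trans sg (leqnSn _)).
rewrite nth_default// mulr0 mulr0 add0r ge => E.
apply: (mulfI p0); rewrite -E mulrCA mulfV// mulr1.
rewrite /alt_sum big_nat_recl// [X in _ + X]big1_seq.
  rewrite bin0 gE eps0 expr0 !mul1r mulr1 addr0.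
  elim: (r) => [|n IH]; first by rewrite big_ord0.
  by rewrite big_ord_recr /= IH subr0 factS natrM mulrC.
move=> k; rewrite mem_index_iota => /andP[_ kr].
by rewrite gE (bigD1 (Ordinal kr))//= subrr mul0r mul0r mulr0.
Qed.

End PartialFractions.

End AlternatingSums.

(** * Rationality of the series of F *)

Section RationalSeries.
Variable R : realType.
Local Notation C := R[i].
Implicit Types (a c x s : C) (D : nat -> C) (P Q : {poly C}).

Definition shift_seq D (r : nat) : C := if r is r'.+1 then D r' else 0.

Lemma shift_addE x D r : shift_add x D r = D r + x * shift_seq D r.
Proof. by case: r => [|r]; rewrite /shift_add /= ?mulr0. Qed.

Lemma iter_shift_addD x m D D' r :
  iter m (shift_add x) (fun k => D k + D' k) r =
  iter m (shift_add x) D r + iter m (shift_add x) D' r.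
Proof.
elim: m r => [//|m IH] r; rewrite !iterS !shift_addE IH.
by case: r => [|r] /=; rewrite ?IH; ring.
Qed.

Lemma iter_shift_addZ x m c D r :
  iter m (shift_add x) (fun k => c * D k) r = c * iter m (shift_add x) D r.
Proof.
elim: m r => [//|m IH] r; rewrite !iterS !shift_addE IH.
by case: r => [|r] /=; rewrite ?IH; ring.
Qed.

Lemma iter_shift_add_shift x m D r :
  iter m (shift_add x) (shift_seq D) r = shift_seq (iter m (shift_add x) D) r.
Proof.
elim: m r => [//|m IH] r; rewrite iterS !shift_addE IH.
case: r => [|r] /=; first by ring.
by rewrite shift_addE IH.
Qed.

(* [D] is the sequence of coefficients of a fraction with denominator a power
   of [1 + x s]. *)
Definition rational_seq x D :=
  exists m N, forall r, (N <= r)%N -> iter m (shift_add x) D r = 0.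

Lemma rational_seq_ext x D D' : D =1 D' -> rational_seq x D -> rational_seq x D'.
Proof. by move=> /funext ->. Qed.

Lemma iter_shift_add_finite x m D N : (forall r, (N <= r)%N -> D r = 0) ->
  forall r, (N + m <= r)%N -> iter m (shift_add x) D r = 0.
Proof.
move=> hD; elim: m => [|m IH] r; first by rewrite addn0; exact: hD.
rewrite addnS iterS shift_addE; case: r => [//|r]; rewrite ltnS => Nr.
by rewrite IH ?(leqW Nr)// add0r /= IH ?mulr0.
Qed.

Lemma rational_seqD x D D' : rational_seq x D -> rational_seq x D' ->
  rational_seq x (fun r => D r + D' r).
Proof.
move=> [m [N hD]] [m' [N' hD']]; exists (m' + m)%N, (maxn (N + m') (N' + m)) => r.
rewrite geq_max => /andP[Nr N'r]; rewrite iter_shift_addD.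
rewrite iterD (iter_shift_add_finite x hD Nr) add0r addnC iterD.
exact: (iter_shift_add_finite x hD').
Qed.

Lemma rational_seqZ x c D : rational_seq x D -> rational_seq x (fun r => c * D r).
Proof.
move=> [m [N hD]]; exists m, N => r Nr.
by rewrite iter_shift_addZ hD// mulr0.
Qed.

Lemma rational_seq_shift x D : rational_seq x D -> rational_seq x (shift_seq D).
Proof.
move=> [m [N hD]]; exists m, N.+1 => -[//|r] Nr.
by rewrite iter_shift_add_shift /= hD.
Qed.

Lemma rational_seq_shift_add x D : rational_seq x (shift_add x D) -> rational_seq x D.
Proof. by move=> [m [N hD]]; exists m.+1, N => r Nr; rewrite iterSr hD. Qed.

(** This is the operator s d/ds. Induction on the exponent of the denominator, using (1 + x s) s D'
    = s ((1 + x s) D)' - x s D for the generating series. *)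
Lemma rational_seq_index x D : rational_seq x D ->
  rational_seq x (fun r => r%:R * D r).
Proof.
move=> [m [N hD]]; elim: m D hD => [|m IH] D hD.
  by exists 0%N, N => r Nr; rewrite /= [D r](hD r Nr) mulr0.
apply: rational_seq_shift_add.
have h1 : rational_seq x (fun r => r%:R * shift_add x D r).
  by apply: IH => r Nr; rewrite -iterSr hD.
have h2 : rational_seq x (fun r => - x * shift_seq D r).
  by apply/rational_seqZ/rational_seq_shift; exists m.+1, N.
apply: rational_seq_ext (rational_seqD h1 h2) => -[|r].
  by rewrite !shift_addE /=; ring.
by rewrite !shift_addE /= -natr1; ring.
Qed.

Lemma rational_series x D : rational_seq x D -> exists P (m : nat),
  forall s l, series (fun r => D r * s ^+ r) @ \oo --> l ->
    (1 + x * s) ^+ m * l = P.[s].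
Proof.
move=> [m [N hD]]; exists (\poly_(r < N) iter m (shift_add x) D r), m => s l hl.
have {hl} : series (fun r => iter m (shift_add x) D r * s ^+ r) @ \oo -->
    (1 + x * s) ^+ m * l.
  elim: (m) => [|k IH]; first by rewrite expr0 mul1r.
  by rewrite exprS -mulrA; exact: shift_add_cvg.
move=> /cvgC_unique; apply.
rewrite horner_poly -(big_mkord xpredT (fun r => iter m (shift_add x) D r * s ^+ r)).
by apply: cvg_series_finite => r Nr; rewrite hD ?mul0r.
Qed.

(** Shape shared by both families: the coefficient of s^r in (1 - s)^(-a) times the pulled-back
    series, by [expansion_coef_weighted]. *)
Definition weighted_coef a (p : nat) (q : nat -> C) (r : nat) : C :=
  alt_sum r (fun k => poch (a + (p * k)%:R) r * q k) / r`!%:R.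

Lemma weighted_coefD a p q q' r : weighted_coef a p (fun k => q k + q' k) r =
  weighted_coef a p q r + weighted_coef a p q' r.
Proof.
rewrite /weighted_coef -mulrDl -alt_sumD; congr (_ / _).
by apply: eq_alt_sum => k; rewrite mulrDr.
Qed.

Lemma weighted_coefZ a p c q r : weighted_coef a p (fun k => c * q k) r =
  c * weighted_coef a p q r.
Proof.
rewrite /weighted_coef mulrA -alt_sumZ; congr (_ / _).
by apply: eq_alt_sum => k; rewrite mulrCA.
Qed.

Lemma weighted_coef_sum a p q r : weighted_coef a p q r =
  \sum_(0 <= k < r.+1) (-1) ^+ k * poch (a + (p * k)%:R) r * q k /
    (k`!%:R * (r - k)`!%:R).
Proof.
rewrite /weighted_coef /alt_sum mulr_suml; apply: eq_big_nat => k /andP[_ kr].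
rewrite -(bin_fact (ltnSE kr)) !natrM.
field; rewrite !natr_fact_neq0 pnatr_eq0 -lt0n bin_gt0.
by rewrite ltnSE.
Qed.

(* Coefficientwise form of [(1 + p s) GF(k q_k) = (s (1 - s) d/ds - a s) GF(q_k)],
   where [GF] is the generating function in [s] of [weighted_coef]. *)
Lemma weighted_coef_index a p q r :
  shift_add p%:R (weighted_coef a p (fun k => k%:R * q k)) r =
  r%:R * weighted_coef a p q r -
  shift_seq (fun r => (r%:R + a) * weighted_coef a p q r) r.
Proof.
rewrite shift_addE; case: r => [|r] /=.
  rewrite !weighted_coef_sum !big_nat1; ring.
rewrite !weighted_coef_sum big_nat_recr//= [in RHS]big_nat_recr//=.
rewrite addrAC [r.+1%:R * (_ + _)]mulrDr [in RHS]addrAC.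
congr (_ + _); last by field; rewrite !natr_fact_neq0.
rewrite !mulr_sumr -sumrN -!big_split /=; apply: eq_big_nat => k /andP[_ kr].
have er : r%:R = (r - k)%:R + k%:R :> C by rewrite -natrD subnK// ltnSE.
rewrite pochS (subSn (ltnSE kr)) factS !natrM -[r.+1%:R]natr1 -[(r - k).+1%:R]natr1 er.
by field; rewrite !natr_fact_neq0 natr1 pnatr_eq0.
Qed.

(** As a polynomial in k, (a + p k)_r has coefficient p^r in degree r. The generating function is
    thus 1 / (1 + p s). *)
Lemma weighted_coef_cst a p r : weighted_coef a p (fun=> 1) r = (- p%:R) ^+ r.
Proof.
rewrite /weighted_coef (@eq_alt_sum _ _ _ (fun k =>
  (linear_prod p%:R (fun i => a + i%:R) r).[0 + k%:R])).
  rewrite alt_sum_poly ?size_linear_prod// coef_linear_prod [in RHS]exprNn.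
  by field; exact: natr_fact_neq0.
by move=> k; rewrite mulr1 add0r poch_linear_prod.
Qed.

(** Each new factor c k + F_n combines multiplication by k, handled by [weighted_coef_index], with a
    scalar multiple; the induction starts from 1 / (1 + p s). *)
Lemma rational_weighted_linear a p c (F : nat -> C) n :
  rational_seq p%:R (weighted_coef a p (fun k => \prod_(i < n) (c * k%:R + F i))).
Proof.
elim: n => [|n IH].
  exists 1%N, 1%N => -[//|r] _; rewrite /= shift_addE /=.
  have -> : (fun k : nat => \prod_(i < 0) (c * k%:R + F i)) = fun=> 1.
    by apply/funext => k; rewrite big_ord0.
  by rewrite !weighted_coef_cst exprS; ring.
pose q (k : nat) := \prod_(i < n) (c * k%:R + F i).
rewrite -/q in IH.
have h1 : rational_seq p%:R (weighted_coef a p (fun k => k%:R * q k)).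
  apply: rational_seq_shift_add.
  have h2 : rational_seq p%:R (shift_seq (fun r => (r%:R + a) * weighted_coef a p q r)).
    apply: rational_seq_shift; apply: rational_seq_ext
      (rational_seqD (rational_seq_index IH) (rational_seqZ a IH)) => r.
    by rewrite mulrDl.
  apply: rational_seq_ext
    (rational_seqD (rational_seq_index IH) (rational_seqZ (-1) h2)) => r.
  by rewrite weighted_coef_index mulN1r.
apply: rational_seq_ext (rational_seqD (rational_seqZ c h1) (rational_seqZ (F n) IH)) => r.
rewrite -!weighted_coefZ -weighted_coefD; congr (_ / _).
by apply: eq_alt_sum => k; rewrite big_ord_recr /= -/(q k); ring.
Qed.

(** With n = p + 1, (a)_{nk} (a + nk)_{r-k} and (a)_{pk} (a + pk)_r both equal (a)_{pk+r}. *)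
Lemma expansion_coef_weighted (h q : nat -> C) (kappa a : C) p r :
  (forall k, h k * kappa ^+ k = (-1) ^+ k * (poch a (p.+1 * k) * q k) / k`!%:R) ->
  expansion_coef h kappa a p.+1 r =
    weighted_coef a p (fun k => poch a (p * k) * q k) r.
Proof.
move=> hk; rewrite weighted_coef_sum; apply: eq_big_nat => k /andP[_ kr].
rewrite hk /rising_coef.
have e : poch a (p.+1 * k) * poch (a + (p.+1 * k)%:R) (r - k) =
    poch a (p * k) * poch (a + (p * k)%:R) r.
  by rewrite -!pochD mulSn addnAC subnKC ?(ltnSE kr)// addnC.
transitivity ((-1) ^+ k * q k * (poch a (p.+1 * k) *
    poch (a + (p.+1 * k)%:R) (r - k)) / (k`!%:R * (r - k)`!%:R)).
  by field; rewrite !natr_fact_neq0.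
by rewrite e; field; rewrite !natr_fact_neq0.
Qed.

Lemma reduced_fraction P Q : Q != 0 -> exists PQ : {poly C} * {poly C},
  [/\ coprimep PQ.1 PQ.2, PQ.2 \is monic & forall y, Q.[y] != 0 ->
    PQ.2.[y] != 0 /\ PQ.1.[y] / PQ.2.[y] = P.[y] / Q.[y]].
Proof.
move=> Q0; pose g := gcdp P Q.
have Pg : P = P %/ g * g by rewrite divpK// dvdp_gcdl.
have Qg : Q = Q %/ g * g by rewrite divpK// dvdp_gcdr.
have Qg0 : Q %/ g != 0 by apply: contraNneq Q0 => h; rewrite Qg h mul0r.
have lc0 : (lead_coef (Q %/ g))^-1 != 0 by rewrite invr_eq0 lead_coef_eq0.
exists ((lead_coef (Q %/ g))^-1 *: (P %/ g), (lead_coef (Q %/ g))^-1 *: (Q %/ g)).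
split=> /=.
- rewrite coprimepZl// coprimepZr// coprimep_div_gcd// Q0 orbT.
  by [].
- by rewrite monicE lead_coefZ mulVf// lead_coef_eq0.
- move=> y; rewrite {1}Qg hornerM mulf_eq0 negb_or => /andP[q0 g0].
  rewrite !hornerZ mulf_neq0//; split=> //.
  rewrite [in RHS]Pg [in RHS]Qg !hornerM.
  by field; rewrite q0 g0 ?lead_coef_eq0 ?Qg0.
Qed.

End RationalSeries.

(** * The two hypergeometric families *)

Section HypergeometricIdentities.
Variable R : realType.
Local Notation C := R[i].
Implicit Types (a c x s y : C) (D : nat -> C) (l : int).

Lemma near_normc (P : C -> Prop) c (d : R) : 0 < d ->
  (forall y, normc (y - c) < d -> P y) -> \forall y \near c, P y.
Proof.
move=> d0 h; apply/nbhs_normP; exists (real_complex R d) => /=.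
  by rewrite ltcR.
move=> y /= hy; apply: h; rewrite normcB -ltcR; exact: hy.
Qed.

Lemma nearP_normc (P : C -> Prop) c : (\forall y \near c, P y) ->
  exists2 d : R, 0 < d & forall y, normc (y - c) < d -> P y.
Proof.
move=> /nbhs_normP[e /= e0 he].
have e_re : e = real_complex R (complex.Re e) by rewrite RRe_real// realE (ltW e0).
exists (complex.Re e); first by rewrite -ltcR -e_re.
move=> y hy; apply: he => /=.
by rewrite normcB -ltcR -e_re in hy.
Qed.

(** If x + i = -m, let q be the integer quotient of m by p: the parameter of index i + (m mod p)
    then equals -q, which is excluded. *)
Lemma lower_ok_arith x i p : (0 < p)%N ->
  lower_ok [seq (x + j%:R) / p%:R | j <- iota i p] ->
  forall m : nat, x + i%:R != - m%:R.
Proof.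
move=> p0 hlow m; have pN0 : p%:R != 0 :> C by rewrite pnatr_eq0 -lt0n.
have := hlow ((x + (i + m %% p)%:R) / p%:R) _ (m %/ p)%N.
have mem : (x + (i + m %% p)%:R) / p%:R \in
    [seq (x + j%:R) / p%:R | j <- iota i p].
  apply/mapP; exists (i + m %% p)%N => //.
  by rewrite mem_iota leq_addr ltn_add2l ltn_pmod.
move=> /(_ mem); apply: contra => /eqP e.
have -> : x = - m%:R - i%:R by rewrite -e addrK.
rewrite natrD {1}(divn_eq m p) natrD natrM; apply/eqP; field.
exact: pN0.
Qed.

Lemma lower_ok_poch_neq0 b m : (forall k : nat, b != - k%:R) -> poch b m != 0 :> C.
Proof. by move=> hb; apply: poch_neq0. Qed.

Lemma poch_reflect x r : poch (1 - x) r = (-1) ^+ r * poch (x - r%:R) r.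
Proof.
elim: r x => [|r IH] x; first by rewrite !poch0 mulr1.
rewrite pochS IH pochSl exprS -natr1 (_ : x - (r%:R + 1) + 1 = x - r%:R); last by ring.
by ring.
Qed.

(** The left side is the reciprocal of (1 - x)_{-(r+1)}: the counterpart of [poch_reflect] for
    negative index. *)
Lemma prod_sub_poch x r :
  \prod_(1 <= i < r.+2) (1 - x - i%:R) = (-1) ^+ r.+1 * poch x r.+1.
Proof.
elim: r => [|r IH].
  by rewrite big_nat1 pochS poch0 addr0 mul1r; ring.
by rewrite big_nat_recr//= IH [poch x r.+2]pochS [in RHS]exprS -natr1; ring.
Qed.

(** * The coefficients of F_l *)

Section FSeries.
Variables (a : C) (l : int) (p : nat).
Hypothesis fdef : forall k : nat, f_coef_defined l (- a) (- p%:R) k.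

(** After reflection, both sides come from two splittings of one rising factorial. The cases are l
    >= 1 and l <= 0, where (c)_{l-1} is a product or the inverse of one. *)
Lemma f_coef_poch k : (forall m : nat, a - l%:~R + 1 != - m%:R) ->
  poch a (p * k) / poch (a - l%:~R + 1) (p * k) = f_coef l (- a) (- p%:R) k.
Proof.
move=> hlow; have h0 := lower_ok_poch_neq0 (p * k) hlow; move: h0.
have := fdef k; rewrite /f_coef_defined /f_coef.
have -> : - a + - p%:R * k%:R + 1 = 1 - (a + (p * k)%:R) by rewrite natrM; ring.
have -> : - a + 1 = 1 - a by ring.
have -> : a - l%:~R + 1 = a - (l - 1)%:~R by rewrite intrB; ring.
case: (l - 1) => r /=.
  move=> [_ _ h1] h0; rewrite !poch_reflect in h1 *.
  rewrite -pmulrn in h0 *.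
  have e : poch (a - r%:R) (p * k) * poch (a + (p * k)%:R - r%:R) r =
      poch (a - r%:R) r * poch a (p * k).
    rewrite [a + _ - _]addrAC -pochD addnC pochD.
    by rewrite subrK.
  apply: (mulfI h0); rewrite mulrCA mulfV// mulr1.
  rewrite mulf_eq0 negb_or in h1; case/andP: h1 => s0 h1.
  by apply: (mulfI h1); rewrite -e; field; rewrite s0 h1.
move=> [h1 h2 h3] h0; rewrite !prod_sub_poch invrK in h1 h2 h3 *.
have e : poch a r.+1 * poch (a + r.+1%:R) (p * k) = poch a (p * k) * poch (a + (p * k)%:R) r.+1.
  by rewrite -!pochD addnC.
rewrite NegzE mulrNz opprK -pmulrn in h0 *.
move: h1; rewrite mulf_eq0 negb_or => /andP[s0 h1].
apply: (mulIf h0); rewrite mulfVK//; apply: (mulIf h1).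
rewrite -e invfM; field.
by rewrite s0 h1.
Qed.

Lemma fhat_weighted r : fhat l (- a) (- p%:R) r =
  (-1) ^+ r * weighted_coef a p (f_coef l (- a) (- p%:R)) r.
Proof.
rewrite /fhat /weighted_coef mulrA -alt_sumZ mulr_suml.
apply: eq_bigr => k _; rewrite /cbinom.
have -> : - a + - p%:R * k%:R - r%:R + 1 = 1 - (a + (p * k)%:R + r%:R).
  by rewrite natrM; ring.
by rewrite poch_reflect addrK; field; exact: natr_fact_neq0.
Qed.

Lemma rational_f_coef :
  rational_seq p%:R (weighted_coef a p (f_coef l (- a) (- p%:R))).
Proof.
move: fdef; rewrite /f_coef_defined /f_coef; case: (l - 1) => n /= hdef.
  apply: rational_seq_ext (rational_seqZ (poch (- a + 1) n)^-1
    (rational_weighted_linear a p (- p%:R) (fun i => - a + 1 + i%:R) n)) => r.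
  rewrite -weighted_coefZ; congr (_ / _); apply: eq_alt_sum => k.
  congr (_ * _); rewrite mulrC; congr (_ / _).
  by apply: eq_bigr => i _; ring.
(* Case l = -n: for r > n, the factor (a + p k)_{n+1} cancels from (a + p k)_r and leaves a
   polynomial of degree less than r in k, so the coefficient is 0 and the series is finite. *)
exists 0%N, n.+1 => r nr; rewrite /= /weighted_coef.
pose g := linear_prod p%:R (fun i => a + (n.+1 + i)%:R) (r - n.+1)%N.
set cst := _^-1^-1.
rewrite (@eq_alt_sum _ _ _ (fun k => (-1) ^+ n.+1 * cst * g.[k%:R])).
  rewrite alt_sumZ alt_sum_poly0 ?mulr0 ?mul0r// (leq_trans (size_linear_prod _ _ _))//.
  by rewrite ltn_subrL (leq_trans _ nr).
move=> k; have [h1 _ _] := hdef k.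
have e : - a + - p%:R * k%:R + 1 = 1 - (a + (p * k)%:R) by rewrite natrM; ring.
rewrite e prod_sub_poch in h1 *.
rewrite -{1}(subnKC nr) pochD /g horner_linear_prod.
have -> : \prod_(i < r - n.+1) (p%:R * k%:R + (a + (n.+1 + i)%:R)) =
    poch (a + (p * k)%:R + n.+1%:R) (r - n.+1).
  by apply: eq_bigr => i _; rewrite natrD natrM; ring.
move: h1; rewrite mulf_eq0 negb_or => /andP[s0 h1].
rewrite invfM -exprVn invrN1.
by field.
Qed.

End FSeries.

Lemma add1_natM_neq0 (p : nat) s : normc s < (p.+1%:R)^-1 ->
  1 + p%:R * s != 0.
Proof.
move=> hs; apply: neq0_Re; rewrite -[p%:R * s]opprK; apply: Re_1B_gt0.
rewrite normcN normcM normc_nat (@le_lt_trans _ _ (p.+1%:R * normc s))//.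
  by rewrite ler_wpM2r ?normc_ge0// ler_nat.
by rewrite -ltr_pdivlMl// mulr1.
Qed.

(** In the variable s = (y - 1) / y the series sums to P(s) / (1 + p s)^m; clearing powers of y
    gives a fraction in y, which is then reduced. *)
Lemma is_F_exists l (A B : C) D p (d : R) : 0 < d ->
  (forall s, normc s <= d -> exists z : C, series (fun r => D r * s ^+ r) @ \oo --> z) ->
  rational_seq p%:R D -> (forall r, fhat l A B r = (-1) ^+ r * D r) ->
  exists PQ, is_F l A B PQ.
Proof.
move=> d0 hcvg /rational_series[P [m hP]] hfhat.
pose N := size P.
(* These are y^(N+m) P(s) and y^(N+m) (1 + p s)^m, as y (1 + p s) = (1 + p) y - p. *)
pose Num : {poly C} := 'X^m * \sum_(i < N) P`_i *: (('X - 1%:P) ^+ i * 'X^(N - i)).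
pose Den : {poly C} := 'X^N * ((1 + p%:R) *: 'X - (p%:R)%:P) ^+ m.
have DenE y : Den.[y] = y ^+ N * ((1 + p%:R) * y - p%:R) ^+ m.
  by rewrite /Den !hornerE.
have Den0 : Den != 0.
  apply: contraTneq (oner_neq0 C) => /(congr1 (fun Q => Q.[1])).
  by rewrite DenE horner0 mulr1 addrK !expr1n mulr1 => ->; rewrite eqxx.
have [PQ [cop mon hPQ]] := reduced_fraction Num Den0.
exists PQ; split=> //.
(* The bound 1/2 keeps |y| >= 1/2, so |s| <= 2 |y - 1|; the other two then give |s| <= d and 1 + p s
   != 0. *)
pose e := Num.min (2^-1) (Num.min (d / 2) ((2 * p.+1%:R)^-1)) : R.
have e0 : 0 < e by rewrite !lt_min !invr_gt0 !divr_gt0 ?mulr_gt0 ?ltr0n.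
apply: (near_normc e0) => y; rewrite !lt_min => /andP[y2 /andP[yd yp]].
have ny : 2^-1 <= normc y.
  have := le_normcD y (1 - y); rewrite addrCA subrr addr0 normc1 normcB => h.
  lra.
have y0 : y != 0 by apply: contraTneq ny => ->; rewrite normc0 -ltNge; lra.
pose s := (y - 1) / y.
have hs : normc s <= normc (y - 1) * 2.
  rewrite normcM normcV ler_wpM2l ?normc_ge0// -[leRHS]invrK lef_pV2 ?posrE//.
  by lra.
have sd : normc s <= d by lra.
have sp : 1 + p%:R * s != 0.
  apply: add1_natM_neq0 => //; rewrite (le_lt_trans hs)//.
  by rewrite -ltr_pdivlMr// -invfM mulrC.
have DenE' : Den.[y] = y ^+ (N + m) * (1 + p%:R * s) ^+ m.
  rewrite DenE exprD -mulrA -exprMn; congr (_ * _ ^+ _).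
  by rewrite /s; field.
have NumE : Num.[y] = y ^+ (N + m) * P.[s].
  rewrite /Num hornerM hornerXn horner_sum [P.[s]]horner_coef.
  rewrite addnC exprD -mulrA; congr (_ * _); rewrite mulr_sumr.
  apply: eq_bigr => i _; rewrite hornerZ hornerM horner_exp hornerXn hornerXsubC.
  have -> : y ^+ N = y ^+ i * y ^+ (N - i) by rewrite -exprD subnKC// ltnW.
  by rewrite /s expr_div_n; field; rewrite expf_neq0.
have Deny : Den.[y] != 0 by rewrite DenE' mulf_neq0 ?expf_neq0.
have [Q0 ->] := hPQ y Deny; split=> //.
have [z hz] := hcvg s sd.
have -> : Num.[y] / Den.[y] = z.
  rewrite NumE DenE' -(hP s z hz).
  by field; rewrite !expf_neq0.
apply: cvgC_ext hz => n; congr (series _ n); apply/funext => r.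
have es : (1 - y) / y = -1 * s by rewrite /s; field.
by rewrite hfhat es [(-1 * s) ^+ r]exprMn [RHS]mulrACA -exprMn mulrNN mul1r expr1n mul1r.
Qed.

(** With y = 1 / (1 - s) one has (1 - y) / y = -s, which cancels the sign of [fhat]. The existence
    of a pair rules out the default value of [F]. *)
Lemma F_series l (A B : C) D : (exists PQ, is_F l A B PQ) ->
  (forall r, fhat l A B r = (-1) ^+ r * D r) ->
  exists2 d : R, 0 < d & forall s, normc s < d ->
    series (fun r => D r * s ^+ r) @ \oo --> F l A B (1 - s)^-1.
Proof.
move=> /(xgetPex ((0, 1) : {poly C} * {poly C})) [_ _ /nearP_normc[d d0 hd]] hfhat.
exists (Num.min (2^-1) (d / 2)); first by rewrite lt_min invr_gt0 divr_gt0 ?ltr0n.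
move=> s; rewrite lt_min => /andP[s2 sd].
have ns : 2^-1 <= normc (1 - s).
  by have := le_normcD (1 - s) s; rewrite subrK normc1; lra.
have s0 : 1 - s != 0 by apply: contraTneq ns => ->; rewrite normc0 -ltNge; lra.
have [|_ hy] := hd (1 - s)^-1.
  have -> : (1 - s)^-1 - 1 = s / (1 - s) by field.
  rewrite normcM normcV (@le_lt_trans _ _ (normc s * 2))//; last by lra.
  by rewrite ler_wpM2l ?normc_ge0// -[leRHS]invrK lef_pV2 ?posrE//; lra.
apply: cvgC_ext hy => n; congr (series _ n); apply/funext => r.
have es : (1 - (1 - s)^-1) / (1 - s)^-1 = -1 * s by field.
by rewrite hfhat es [(-1 * s) ^+ r]exprMn [LHS]mulrACA -exprMn mulrNN mul1r expr1n mul1r.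
Qed.

End HypergeometricIdentities.

(** * Pullback of hypergeometric series by the Belyi map *)

Section Pullbacks.
Variable R : realType.
Local Notation C := R[i].
Implicit Types (a c s : C).

Lemma hyp_power_expansion (al be : seq C) kappa a n :
  size al = (size be).+1 -> lower_ok be ->
  exists2 d : R, 0 < d & forall s, normc s <= d -> exists z : C,
    [/\ hyp_cvg al be (kappa * (s / (1 - s) ^+ n)),
        hyp al be (kappa * (s / (1 - s) ^+ n)) = cpow (1 - s) a * z &
        series (fun r => expansion_coef (hyp_coef al be) kappa a n r * s ^+ r)
          @ \oo --> z].
Proof.
move=> sab hbe; have [M M0 hM] := hyp_coef_bound sab hbe.
have [d d0 hd] := power_expansion kappa a n M0 hM.
exists d; first exact: d0.
move=> s /hd[z [hz1 hz2]]; exists z; split; [|exact: (cvgC_lim hz1)|exact: hz2].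
exact: (cvgP _ hz1).
Qed.

Variable p : nat.
Hypothesis p_gt0 : (0 < p)%N.
Let kappa : C := - (p.+1%:R ^+ p.+1 / p%:R ^+ p).

Lemma kappa_exp k : kappa ^+ k =
  (-1) ^+ k * (p.+1%:R ^+ (p.+1 * k) / p%:R ^+ (p * k)).
Proof. by rewrite /kappa [LHS]exprNn expr_div_n -!exprM. Qed.

Lemma natp_neq0 : p%:R != 0 :> C.
Proof. by rewrite pnatr_eq0 -lt0n. Qed.

(** Up to the factor (1 - s)^a, both sides are limits of one power series in s. *)
Lemma hypergeometric_F a (l : int) :
  let up := [seq (a + j%:R) / p.+1%:R | j <- iota 0 p.+1] in
  let low := [seq (a - l%:~R + j%:R) / p%:R | j <- iota 1 p] in
  lower_ok low ->
  (forall k : nat, f_coef_defined l (- a) (- p%:R) k) ->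
  \forall s \near (0 : C),
    hyp_cvg up low (zeta p s) /\
    hyp up low (zeta p s) = cpow (1 - s) a * F l (- a) (- p%:R) (1 - s)^-1.
Proof.
move=> up low hlow hdef; have pN0 := natp_neq0.
have hlow' := lower_ok_arith p_gt0 hlow.
have [||d d0 hd] := @hyp_power_expansion up low kappa a p.+1.
- by rewrite !size_map !size_iota.
- exact: hlow.
set D := expansion_coef _ _ _ _ in hd.
pose q k := (poch (a - l%:~R + 1) (p * k))^-1.
have DE r : D r = weighted_coef a p (f_coef l (- a) (- p%:R)) r.
  rewrite /D (@expansion_coef_weighted _ _ q).
    by congr (_ / _); apply: eq_alt_sum => k; rewrite /q f_coef_poch.
  (* The powers of p + 1 and p from [prod_poch_arith] cancel against [kappa ^+ k], leaving
     (-1)^k. *)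
  move=> k; rewrite kappa_exp /hyp_coef /up /low !prod_poch_arith//.
  rewrite addr0 poch1 /q.
  have h0 := lower_ok_poch_neq0 (p * k) hlow'.
  by field; rewrite natr_fact_neq0 h0 !expf_neq0.
have Drat : rational_seq p%:R D.
  by rewrite (funext DE); exact: rational_f_coef.
have hfhat r : fhat l (- a) (- p%:R) r = (-1) ^+ r * D r by rewrite DE fhat_weighted.
have Fex : exists PQ, is_F l (- a) (- p%:R) PQ.
  apply: (is_F_exists d0 _ Drat hfhat) => s /hd[z [_ _ hz]].
  by exists z.
have [d' d'0 hd'] := F_series Fex hfhat.
apply: (@near_normc _ _ _ (Num.min d d')); first by rewrite lt_min d0.
move=> s; rewrite subr0 lt_min => /andP[sd sd'].
have [z [h1 h2 h3]] := hd s (ltW sd); split; first exact: h1.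
by rewrite -(cvgC_unique h3 (hd' s sd')); exact: h2.
Qed.

Section PartialFractionParameter.
Variables (a c : C) (l : nat).
Let e : C := (a + c - l%:R) / p%:R.
Let up := rcons [seq (a + j%:R) / p.+1%:R | j <- iota 0 p.+1]
                ((a + c - l%:R) / p%:R).
Let low := rcons [seq (a - l%:R + j%:R) / p%:R | j <- iota 0 p]
                 ((a + c - l%:R + p%:R) / p%:R).
Hypothesis hlow : lower_ok low.

(** This is e / (e + k), in the form contributed by the parameters e and e + 1; at e = 0 it is still
    1 for k = 0. *)
Definition partial_fraction_weight e (k : nat) : C := poch e k / poch (e + 1) k.
Let eps := partial_fraction_weight e.

Lemma lower_ok_base : forall m : nat, a - l%:R != - m%:R.
Proof.
move=> m; rewrite -[a - l%:R]addr0.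
apply: (@lower_ok_arith _ (a - l%:R) 0 p p_gt0) => b hb.
by apply: hlow; rewrite mem_rcons inE hb orbT.
Qed.

Lemma lower_ok_e1 : forall m : nat, e + 1 != - m%:R.
Proof.
have -> : e + 1 = (a + c - l%:R + p%:R) / p%:R.
  by rewrite /e; field; exact: natp_neq0.
by apply: hlow; rewrite mem_rcons inE eqxx.
Qed.

Lemma poch_e1_neq0 k : poch (e + 1) k != 0.
Proof. exact: (lower_ok_poch_neq0 k lower_ok_e1). Qed.

Lemma partial_fraction_weightE k : (e + k%:R) * eps k = e.
Proof.
rewrite /eps /partial_fraction_weight mulrA [_ * poch e k]mulrC -pochS pochSl.
by rewrite mulfK// poch_e1_neq0.
Qed.

Lemma partial_fraction_weight0 : eps 0%N = 1.
Proof. by rewrite /eps /partial_fraction_weight !poch0 divr1. Qed.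

Lemma expansion_coef_eps r :
  expansion_coef (hyp_coef up low) kappa a p.+1 r =
  weighted_coef a p
    (fun k => poch a (p * k) / poch (a - l%:R) (p * k) * eps k) r.
Proof.
rewrite (@expansion_coef_weighted _ _
    (fun k => (poch (a - l%:R) (p * k))^-1 * eps k)).
  by congr (weighted_coef _ _ _ _); apply/funext => k; rewrite mulrA.
move=> k; rewrite kappa_exp /hyp_coef /up /low !big_rcons !prod_poch_arith//.
rewrite /= !addr0 poch1 -/e /eps /partial_fraction_weight.
have -> : (a + c - l%:R + p%:R) / p%:R = e + 1.
  by rewrite /e; field; exact: natp_neq0.
have h0 := lower_ok_poch_neq0 (p * k) lower_ok_base.
by field; rewrite natr_fact_neq0 h0 poch_e1_neq0 !expf_neq0 ?natp_neq0.
Qed.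

Lemma horner_linear_prod_e n x :
  (linear_prod p%:R (fun i => x + i%:R) n).[- e] = poch (x - p%:R * e) n.
Proof.
by rewrite horner_linear_prod; apply: eq_bigr => i _; ring.
Qed.

Lemma p_mul_e : p%:R * e = a + c - l%:R.
Proof. by rewrite /e mulrCA mulfV ?mulr1// natp_neq0. Qed.

End PartialFractionParameter.

(** For l = 0 the quotient of rising factorials is 1, and (a + p k)_r has degree at most r in k, so
    only the partial fraction term survives, with a - p e = -c. *)
Lemma expansion_coef0 a c r (e := (a + c - 0%:R) / p%:R) :
  lower_ok (rcons [seq (a - 0%:R + j%:R) / p%:R | j <- iota 0 p]
                  ((a + c - 0%:R + p%:R) / p%:R)) ->
  weighted_coef a p
    (fun k => poch a (p * k) / poch (a - 0%:R) (p * k) *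
              partial_fraction_weight e k) r =
  poch (- c) r / poch (e + 1) r.
Proof.
move=> hlow; have hE := partial_fraction_weightE hlow.
rewrite /weighted_coef (@eq_alt_sum _ _ _ (fun k =>
  (linear_prod p%:R (fun i => a + i%:R) r).[k%:R] * partial_fraction_weight e k)).
  rewrite (alt_sum_eps_poly hE); last by rewrite (leq_trans (size_linear_prod _ _ _)).
  rewrite nth_default ?size_linear_prod// !mulr0 add0r.
  rewrite (alt_sum_eps hE) ?(partial_fraction_weight0 a c 0) ?(poch_e1_neq0 hlow)//.
  rewrite horner_linear_prod_e p_mul_e (_ : a - (a + c - 0%:R) = - c); last by ring.
  by field; rewrite natr_fact_neq0 (poch_e1_neq0 hlow).
move=> k; rewrite poch_linear_prod subr0 mulfV ?mul1r//.
by apply: lower_ok_poch_neq0 => m; have := lower_ok_base hlow m; rewrite subr0.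
Qed.

(** For l = 1 the quotient is (a - 1 + p k) / (a - 1), which raises the degree to r + 1 and adds a
    multiple of (-1)^r p^(r+1). These terms are geometric, and multiplication by 1 + p s cancels
    them for r >= 1. *)
Lemma expansion_coef1 a c r (e := (a + c - 1%:R) / p%:R)
    (f := (a - 1) / p.+1%:R) :
  lower_ok (rcons [seq (a - 1%:R + j%:R) / p%:R | j <- iota 0 p]
                  ((a + c - 1%:R + p%:R) / p%:R)) ->
  shift_add p%:R (weighted_coef a p
    (fun k => poch a (p * k) / poch (a - 1%:R) (p * k) *
              partial_fraction_weight e k)) r =
  poch (- c) r * (f + r%:R) / (f * poch (e + 1) r).
Proof.
move=> hlow; have hE := partial_fraction_weightE hlow; have hp := poch_e1_neq0 hlow.
rewrite -/e in hE hp.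
have a1 : a - 1 != 0 by have := lower_ok_base hlow 0; rewrite oppr0.
have W n : weighted_coef a p (fun k => poch a (p * k) / poch (a - 1%:R) (p * k) *
      partial_fraction_weight e k) n =
    (poch (- c) n.+1 / poch (e + 1) n + e * (-1) ^+ n * p%:R ^+ n.+1) / (a - 1).
  rewrite /weighted_coef (@eq_alt_sum _ _ _ (fun k => (a - 1)^-1 *
    ((linear_prod p%:R (fun i => a - 1 + i%:R) n.+1).[k%:R] *
     partial_fraction_weight e k))).
    rewrite alt_sumZ (alt_sum_eps_poly hE) ?size_linear_prod//.
    rewrite coef_linear_prod (alt_sum_eps hE) ?(partial_fraction_weight0 a c 1)//.
    rewrite horner_linear_prod_e p_mul_e.
    rewrite (_ : a - 1 - (a + c - 1%:R) = - c) -/e; last by ring.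
    by field; rewrite natr_fact_neq0 hp a1.
  move=> k; rewrite -poch_linear_prod [in RHS]pochSl.
  have -> : a - 1 + (p * k)%:R + 1 = a + (p * k)%:R by ring.
  have h0 : poch (a - 1) (p * k) != 0 by exact: (lower_ok_poch_neq0 _ (lower_ok_base hlow)).
  have E : poch (a - 1) (p * k) * (a - 1 + (p * k)%:R) = (a - 1) * poch a (p * k).
    by rewrite -pochS pochSl subrK.
  have -> : poch a (p * k) / poch (a - 1) (p * k) = (a - 1 + (p * k)%:R) / (a - 1).
    by apply/eqP; rewrite eqr_div// [_ == _]eq_sym mulrC E mulrC.
  by field.
rewrite shift_addE; have pN0 := natp_neq0; case: r => [|r] /=.
  rewrite W pochS !poch0 /f /e; field.
  by rewrite a1 pN0 nat1r pnatr_eq0.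
rewrite !W; have := hp r; have := hp r.+1.
rewrite !pochS mulf_eq0 negb_or => /andP[_ er] h1.
rewrite /f -[r.+1%:R]natr1 -[p.+1%:R]natr1 [p%:R ^+ r.+2]exprS [(-1) ^+ r.+1]exprS.
(* Eliminating [c] in favour of [e] leaves a rational identity in independent quantities. *)
have c_e : c = p%:R * e - a + 1 by rewrite p_mul_e; ring.
move: (poch (- c) r) (poch (e + 1) r) h1 (p%:R ^+ r.+1) ((-1) ^+ r) => X Y Y0 Z S.
rewrite c_e; field.
by rewrite Y0 a1 natr1 pnatr_eq0 er.
Qed.

End Pullbacks.

(** * The second family: comparison with G_0 and G_1 *)

Section HypergeometricG.
Variable R : realType.
Local Notation C := R[i].
Implicit Types (a c s : C).
Variable p : nat.
Hypothesis p_gt0 : (0 < p)%N.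

(** Common part of l = 0 and l = 1: [v] relates the pulled-back series to that of G_l, and will be 1
    or 1 + p s. *)
Lemma hypergeometric_G_of_series a c (l : nat) (v : C -> C) :
  let up := rcons [seq (a + j%:R) / p.+1%:R | j <- iota 0 p.+1]
                  ((a + c - l%:R) / p%:R) in
  let low := rcons [seq (a - l%:R + j%:R) / p%:R | j <- iota 0 p]
                   ((a + c - l%:R + p%:R) / p%:R) in
  let Gup := G_up l (- a) (- p%:R) (- c) in
  let Glow := G_low l (- a) (- p%:R) (- c) in
  let D := weighted_coef a p (fun k => poch a (p * k) / poch (a - l%:R) (p * k) *
    partial_fraction_weight ((a + c - l%:R) / p%:R) k) in
  lower_ok low ->
  (forall s, 1 - s != 0 -> G l (- a) (- p%:R) (- c) (1 - s)^-1 =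
     (v s)^-1 * hyp Gup Glow (((1 - s)^-1 - 1) / (1 - s)^-1)) ->
  (forall s, normc s < p.+1%:R^-1 -> v s != 0) ->
  (forall s z, series (fun r => D r * s ^+ r) @ \oo --> z ->
     series (fun r => hyp_coef Gup Glow r * s ^+ r) @ \oo --> v s * z) ->
  \forall s \near (0 : C),
    let y := (1 - s)^-1 in
    [/\ hyp_cvg up low (zeta p s),
        hyp_cvg Gup Glow ((y - 1) / y)
      & hyp up low (zeta p s) =
          cpow (1 - s) a * G l (- a) (- p%:R) (- c) y].
Proof.
move=> up low Gup Glow D hlow hG hv hser.
have [||d d0 hd] := @hyp_power_expansion _ up low
  (- (p.+1%:R ^+ p.+1 / p%:R ^+ p)) a p.+1.
- by rewrite !size_rcons !size_map !size_iota.
- exact: hlow.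
apply: (@near_normc _ _ _ (Num.min d p.+1%:R^-1)); first by rewrite lt_min d0 invr_gt0 ltr0n.
move=> s; rewrite subr0 lt_min => /andP[sd sp].
have [z [h1 h2 h3]] := hd s (ltW sd).
have s0 : 1 - s != 0.
  apply: neq0_Re; apply: Re_1B_gt0; apply: (lt_le_trans sp).
  by rewrite invf_le1 ?ltr0n// ler1n.
have hz : series (fun r => D r * s ^+ r) @ \oo --> z.
  apply: cvgC_ext h3 => n; congr (series _ n); apply/funext => r.
  by rewrite expansion_coef_eps.
have hGs := hser s z hz.
have es : ((1 - s)^-1 - 1) / (1 - s)^-1 = s by field.
split.
- exact: h1.
- by rewrite es; exact: (cvgP _ hGs).
- rewrite hG// es (_ : hyp Gup Glow s = v s * z); last exact: (cvgC_lim hGs).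
  by rewrite mulKf ?hv//; exact: h2.
Qed.

Lemma hypergeometric_G a c (l : nat) : (l <= 1)%N ->
  let up := rcons [seq (a + j%:R) / p.+1%:R | j <- iota 0 p.+1]
                  ((a + c - l%:R) / p%:R) in
  let low := rcons [seq (a - l%:R + j%:R) / p%:R | j <- iota 0 p]
                   ((a + c - l%:R + p%:R) / p%:R) in
  let Gup := G_up l (- a) (- p%:R) (- c) in
  let Glow := G_low l (- a) (- p%:R) (- c) in
  lower_ok low -> lower_ok Glow ->
  \forall s \near (0 : C),
    let y := (1 - s)^-1 in
    [/\ hyp_cvg up low (zeta p s),
        hyp_cvg Gup Glow ((y - 1) / y)
      & hyp up low (zeta p s) =
          cpow (1 - s) a * G l (- a) (- p%:R) (- c) y].
Proof.
have pN0 : p%:R != 0 :> C by exact: natp_neq0.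
case: l => [|[|//]] _ up low Gup Glow hlow hGlow.
  have e1 : (- a - c) / - p%:R + 1 = (a + c - 0%:R) / p%:R + 1 by field.
  apply: (@hypergeometric_G_of_series a c 0 (fun=> 1)); first exact: hlow.
  - by move=> s _; rewrite invr1 mul1r.
  - by move=> s _; exact: oner_neq0.
  - move=> s z hz; rewrite mul1r; apply: cvgC_ext hz => n; congr (series _ n).
    apply/funext => r; rewrite expansion_coef0//; congr (_ * _).
    rewrite /hyp_coef /G_up /G_low /= /G0_up /G0_low !big_cons !big_nil e1.
    have h1 := poch_e1_neq0 p_gt0 hlow r; have h2 := natr_fact_neq0 R r.
    by rewrite poch1; field; rewrite h1 h2.
have e1 : (- a - c + 1) / - p%:R + 1 = (a + c - 1%:R) / p%:R + 1 by field.
have n0 : p.+1%:R != 0 :> C by rewrite pnatr_eq0.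
have n0' : - p%:R - 1 != 0 :> C by rewrite -opprD natr1 oppr_eq0.
have e2 : (- a + 1) / (- p%:R - 1) = (a - 1) / p.+1%:R.
  by rewrite -natr1 in n0 *; field; rewrite n0.
apply: (@hypergeometric_G_of_series a c 1 (fun s => 1 + p%:R * s)); first exact: hlow.
- move=> s s0; congr (_ * _).
  (* At B = -p and y = 1 / (1 - s), the prefactor of G_1 is 1 / (1 + p s). *)
  have -> : (1 - - p%:R) * (1 - s)^-1 + - p%:R = (1 + p%:R * s) / (1 - s) by field.
  by rewrite invfM invrK mulrCA mulVf ?mulr1.
- by move=> s; exact: add1_natM_neq0.
- move=> s z /(shift_add_cvg (x := p%:R)) hz; apply: cvgC_ext hz => n; congr (series _ n).
  apply/funext => r; rewrite expansion_coef1//; congr (_ * _).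
  rewrite /hyp_coef /G_up /G_low /= /G1_up /G1_low !big_cons !big_nil e1 e2.
  have h1 := poch_e1_neq0 p_gt0 hlow r; have h2 := natr_fact_neq0 R r.
  have hf : forall m : nat, (a - 1) / p.+1%:R != - m%:R :> C.
    by rewrite -e2; apply: hGlow; rewrite !inE eqxx orbT.
  have h3 := lower_ok_poch_neq0 r hf; have := hf 0%N; rewrite oppr0 => f0.
  set f := (a - 1) / p.+1%:R in h3 f0 *.
  (* The parameters f + 1 and f of G_1 contribute (f + 1)_r / (f)_r = (f + r) / f. *)
  have E : poch f r * (f + r%:R) = f * poch (f + 1) r by rewrite -pochS pochSl.
  rewrite poch1 (_ : poch (f + 1) r = poch f r * (f + r%:R) / f).
    by field; rewrite h1 h2 h3 f0.
  by rewrite E mulrAC mulfV ?mul1r.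
Qed.

End HypergeometricG.

(** * The Belyi map *)

Section BelyiMap.
Variable R : realType.
Local Notation C := R[i].
Implicit Types (f g : C -> C) (z w s d : C) (x q : P1 R).

Lemma is_deriveC_eq f g z d d' : f =1 g -> d = d' ->
  is_derive z (1 : C) f d -> is_derive z (1 : C) g d'.
Proof. by move=> /funext -> ->. Qed.

Lemma is_deriveC_cst (k : C) z : is_derive z (1 : C) (fun=> k) 0.
Proof. exact: is_derive_cst. Qed.

Lemma is_deriveC_id z : is_derive z (1 : C) (fun w => w) 1.
Proof. exact: is_derive_id. Qed.

Lemma is_deriveC_add f g z d d' : is_derive z (1 : C) f d ->
  is_derive z (1 : C) g d' -> is_derive z (1 : C) (fun w => f w + g w) (d + d').
Proof. by move=> hf hg; exact: (is_deriveD hf hg). Qed.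

Lemma is_deriveC_mul f g z d d' : is_derive z (1 : C) f d ->
  is_derive z (1 : C) g d' ->
  is_derive z (1 : C) (fun w => f w * g w) (d * g z + f z * d').
Proof.
move=> hf hg; apply: is_deriveC_eq (is_deriveM hf hg) => //.
by rewrite -![_ *: _]/(_ * _) addrC [g z * d]mulrC.
Qed.

Lemma is_deriveC_mull (k : C) g z d : is_derive z (1 : C) g d ->
  is_derive z (1 : C) (fun w => k * g w) (k * d).
Proof.
move=> hg; apply: is_deriveC_eq (is_deriveC_mul (is_deriveC_cst k z) hg) => //.
by rewrite mul0r add0r.
Qed.

Lemma is_deriveC_exp f z d n : is_derive z (1 : C) f d ->
  is_derive z (1 : C) (fun w => f w ^+ n) (n%:R * f z ^+ n.-1 * d).
Proof.
move=> hf; elim: n => [|n IH].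
  by rewrite !mul0r; apply: is_deriveC_eq (is_deriveC_cst 1 z).
apply: is_deriveC_eq (is_deriveC_mul hf IH) => [w|]; first by rewrite exprS.
case: n {IH} => [|n] /=; first by ring.
by rewrite -[n.+2%:R]natr1 !exprS; ring.
Qed.

Lemma is_deriveC_inv f z d : f z != 0 -> is_derive z (1 : C) f d ->
  is_derive z (1 : C) (fun w => (f w)^-1) (- d / f z ^+ 2).
Proof.
move=> f0 [df <-]; apply: DeriveDef; first exact: derivableV.
by rewrite deriveV// -[_ *: _]/(_ * _) mulrC mulrN mulNr.
Qed.

Lemma is_deriveC_near f g z d : (\forall w \near z, f w = g w) ->
  is_derive z (1 : C) g d -> is_derive z (1 : C) f d.
Proof.
move=> fg [dg <-]; apply: DeriveDef.
  apply: (near_eq_derivable _ dg).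
  by apply: filterS fg => w ->.
exact: near_eq_derive.
Qed.

(** Serves at s = 1, a pole of order p + 1 >= 2, and at infinity, a zero of order p, when p > 1. *)
Lemma is_deriveC_double_zero g d : is_derive (0 : C) (1 : C) g d ->
  is_derive (0 : C) (1 : C) (fun w => w * (w * g w)) 0.
Proof.
move=> hg.
apply: is_deriveC_eq (is_deriveC_mul (is_deriveC_id 0)
  (is_deriveC_mul (is_deriveC_id 0) hg)) => //.
by ring.
Qed.

Lemma near_neq (z0 k : C) : z0 != k -> \forall w \near (0 : C), z0 + w != k.
Proof.
move=> zk; have d0 : 0 < normc (k - z0).
  rewrite lt_neqAle normc_ge0 andbT eq_sym; apply: contra zk => /eqP/eq0_normc/eqP.
  by rewrite subr_eq0 eq_sym.
apply: (near_normc d0) => w; rewrite subr0; apply: contraTneq => <-.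
by rewrite addrAC subrr add0r ltxx.
Qed.

Variable p : nat.
Hypothesis p_gt0 : (0 < p)%N.
Let K : C := p.+1%:R ^+ p.+1 / p%:R ^+ p.

Lemma belyi_const_neq0 : K != 0.
Proof. by rewrite /K mulf_neq0 ?invr_eq0 ?expf_neq0 ?pnatr_eq0 -?lt0n. Qed.

Lemma zetaE s : zeta p s = - K * (s / (1 - s) ^+ p.+1).
Proof. by []. Qed.

Lemma zeta_local s : s != 1 ->
  is_derive (0 : C) (1 : C) (local_expr (@zetaP1 R p) (Some s))
    (- K * ((1 + p%:R * s) / (1 - s) ^+ p.+2)).
Proof.
move=> s1; have s0 : 1 - s != 0 by rewrite subr_eq0 eq_sym.
apply: (is_deriveC_near (g := fun w => - K * ((s + w) * ((1 - (s + w)) ^+ p.+1)^-1) - zeta p s)).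
  apply: filterS (near_neq s1) => w sw.
  by rewrite /local_expr /= (negbTE s1) (negbTE sw).
have hw : is_derive (0 : C) (1 : C) (fun w => s + w) 1.
  by apply: is_deriveC_eq (is_deriveC_add (is_deriveC_cst s 0) (is_deriveC_id 0)) => //;
    rewrite add0r.
have h1 := is_deriveC_add (is_deriveC_cst 1 0) (is_deriveC_mull (-1) hw).
have n0 : (1 + -1 * (s + 0)) ^+ p.+1 != 0 by rewrite expf_neq0// addr0 mulN1r.
have hV := is_deriveC_inv (f := fun w => (1 + -1 * (s + w)) ^+ p.+1) n0
  (is_deriveC_exp p.+1 h1).
have h := is_deriveC_add (is_deriveC_mull (- K) (is_deriveC_mul hw hV))
  (is_deriveC_cst (- zeta p s) 0).
apply: is_deriveC_eq h => [w|]; first by rewrite mulN1r.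
rewrite !addr0 !mulN1r -[p.+1%:R]natr1 /= !exprS.
by field; rewrite expf_neq0// s0.
Qed.

Lemma holomorphic_at_finite s : s != 1 -> holomorphic_at (@zetaP1 R p) (Some s).
Proof.
move=> s1; split; last by have [] := zeta_local s1.
apply: filterS (near_neq s1) => w sw.
by rewrite /= (negbTE s1) (negbTE sw).
Qed.

Lemma ramified_finiteP s : s != 1 ->
  ramified_at (@zetaP1 R p) (Some s) <-> 1 + p%:R * s = 0.
Proof.
move=> s1; have s0 : 1 - s != 0 by rewrite subr_eq0 eq_sym.
rewrite /ramified_at; have [_ ->] := zeta_local s1; split=> [/eqP|->].
  rewrite mulf_eq0 oppr_eq0 (negbTE belyi_const_neq0) /= mulf_eq0 invr_eq0.
  by rewrite expf_eq0 (negbTE s0) andbF orbF => /eqP.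
by rewrite mul0r mulr0.
Qed.

Lemma zeta_local1 :
  is_derive (0 : C) (1 : C) (local_expr (@zetaP1 R p) (Some 1)) 0.
Proof.
have h0 : (fun w : C => 1 + w) 0 != 0 by rewrite addr0 oner_neq0.
have hV := is_deriveC_inv (f := fun w => 1 + w) h0 (is_deriveC_add (is_deriveC_cst 1 0) (is_deriveC_id 0)).
(* Cofactor of w^2 in 1 / zeta(1 + w) = -K^(-1) (-w)^(p+1) / (1 + w). *)
have hg := is_deriveC_mull (- K^-1 * (-1) ^+ p.+1)
  (is_deriveC_mul (is_deriveC_exp p.-1 (is_deriveC_id 0)) hV).
apply: is_deriveC_near (is_deriveC_double_zero hg).
apply: filterS (near_neq (oner_neq0 C)) => w w1.
rewrite /local_expr /= eqxx -subr_eq0 addrAC subrr add0r.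
(* At w = 0 the map takes the value infinity, whose coordinate is 0. *)
have [->|w0] := eqVneq w 0; first by rewrite mul0r.
have ep : w ^+ p.+1 = w * (w * w ^+ p.-1) by rewrite -!exprS prednK.
have e : (1 - (1 + w)) ^+ p.+1 = (-1) ^+ p.+1 * (w * (w * w ^+ p.-1)).
  by rewrite -ep -exprMn mulN1r opprD addrA subrr add0r.
change ((zeta p (1 + w))^-1 =
  w * (w * (- K^-1 * (-1) ^+ p.+1 * (w ^+ p.-1 / (1 + w))))).
have s0 : (-1) ^+ p.+1 != 0 :> C by rewrite expf_neq0// oppr_eq0 oner_eq0.
have W0 : w ^+ p.-1 != 0 by rewrite expf_neq0.
rewrite zetaE e; move: ((-1) ^+ p.+1) s0 (w ^+ p.-1) W0 (K) belyi_const_neq0.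
move=> S s0 W W0 k k0; field.
by rewrite w1 k0 s0 W0 w0.
Qed.

Lemma holomorphic_at1 : holomorphic_at (@zetaP1 R p) (Some 1).
Proof.
split; last by have [] := zeta_local1.
apply: filterS (near_neq (oner_neq0 C)) => w w1.
rewrite /= eqxx /= -subr_eq0 addrAC subrr add0r.
have [//|w0] := eqVneq w 0; move=> [] /eqP; rewrite zetaE.
rewrite mulf_eq0 oppr_eq0 (negbTE belyi_const_neq0) /= mulf_eq0 (negbTE w1) /=.
by rewrite invr_eq0 expf_eq0 /= opprD addrA subrr add0r oppr_eq0 (negbTE w0).
Qed.

Lemma near_inv_neq1 : \forall w \near (0 : C), w^-1 != 1.
Proof.
have h : (0 : C) != 1 by rewrite eq_sym oner_neq0.
apply: filterS (near_neq h) => w; rewrite add0r; apply: contra => /eqP e.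
by rewrite -[w]invrK e invr1.
Qed.

Lemma zeta_inv w : w != 0 -> w^-1 != 1 ->
  zeta p w^-1 = - K * (w ^+ p * ((w - 1) ^+ p.+1)^-1).
Proof.
move=> w0 w1; have w1' : w - 1 != 0.
  by rewrite subr_eq0; apply: contra w1 => /eqP ->; rewrite invr1.
rewrite zetaE (_ : 1 - w^-1 = (w - 1) / w); last by field.
rewrite expr_div_n [w ^+ p.+1]exprS; field.
by rewrite w0 !expf_neq0.
Qed.

Lemma zeta_local_infty :
  (\forall w \near (0 : C), local_expr (@zetaP1 R p) None w =
     - K * (w ^+ p * ((w - 1) ^+ p.+1)^-1)).
Proof.
apply: filterS near_inv_neq1 => w w1.
rewrite /local_expr /=; have [->|w0] := eqVneq w 0.
  by rewrite /= subr0 expr0n eqn0Ngt p_gt0 mul0r mulr0.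
by rewrite /= (negbTE w1) subr0 zeta_inv.
Qed.

Lemma is_deriveC_inv_pow n : exists d,
  is_derive (0 : C) (1 : C) (fun w => ((w - 1) ^+ n)^-1) d.
Proof.
have h0 : (fun w : C => (w - 1) ^+ n) 0 != 0.
  by rewrite expf_neq0// add0r oppr_eq0 oner_neq0.
eexists; apply: (is_deriveC_inv (f := fun w => (w - 1) ^+ n) h0); exact: is_deriveC_exp.
Qed.

Lemma holomorphic_at_infty : holomorphic_at (@zetaP1 R p) None.
Proof.
split.
  apply: filterS near_inv_neq1 => w w1 /=.
  by have [//|w0] := eqVneq w 0; rewrite /= (negbTE w1).
have [d hd] := is_deriveC_inv_pow p.+1.
by have [] := is_deriveC_near zeta_local_infty
  (is_deriveC_mull (- K) (is_deriveC_mul (is_deriveC_exp p (is_deriveC_id 0)) hd)).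
Qed.

Lemma ramified_infty : (1 < p)%N -> ramified_at (@zetaP1 R p) None.
Proof.
move=> p1; have [d hd] := is_deriveC_inv_pow p.+1.
have h := is_deriveC_double_zero (is_deriveC_mull (- K)
  (is_deriveC_mul (is_deriveC_exp p.-2 (is_deriveC_id 0)) hd)).
have [] // : is_derive (0 : C) (1 : C) (local_expr (@zetaP1 R p) None) 0.
apply: is_deriveC_near h; apply: filterS zeta_local_infty => w ->.
by rewrite -{1}(prednK p_gt0) -{1}(prednK (_ : 0 < p.-1)%N) ?exprS; [ring|case: (p) p1 => [|[]]].
Qed.

Lemma zeta_critical s : 1 + p%:R * s = 0 -> zeta p s = 1.
Proof.
move=> h; have pN0 : p%:R != 0 :> C by rewrite pnatr_eq0 -lt0n.
have n0 : p.+1%:R != 0 :> C by rewrite pnatr_eq0.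
have -> : s = - p%:R^-1.
  by apply: (mulfI pN0); rewrite mulrN mulfV//; apply/eqP; rewrite -addr_eq0 addrC h.
rewrite zetaE /K (_ : 1 - - p%:R^-1 = p.+1%:R / p%:R); last by rewrite -natr1; field.
rewrite expr_div_n [p%:R ^+ p.+1]exprS.
by field; rewrite !expf_neq0// pN0.
Qed.

Lemma zetaP1_Belyi : Belyi_map (@zetaP1 R p).
Proof.
split=> [[s|]|q [[s|] <-]].
- by have [->|s1] := eqVneq s 1; [exact: holomorphic_at1 | exact: holomorphic_at_finite].
- exact: holomorphic_at_infty.
- move=> hr; rewrite /zetaP1; have [_|s1] := eqVneq s 1; first exact: Or33.
  by apply: Or32; rewrite zeta_critical//; exact/ramified_finiteP.
- by move=> _; exact: Or31.
Qed.

(** A repeated entry r would be a zero of the derivative, by the product rule. *)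
Lemma uniq_roots_simple (rs : seq C) :
  (forall z, root (\prod_(r <- rs) ('X - r%:P)) z ->
     ~~ root (\prod_(r <- rs) ('X - r%:P))^`() z) -> uniq rs.
Proof.
elim: rs => [//|r rs IH] h /=; rewrite big_cons in h.
have dE z : ((('X - r%:P) * \prod_(r <- rs) ('X - r%:P))^`()).[z] =
    (\prod_(r <- rs) ('X - r%:P)).[z] +
    (z - r) * ((\prod_(r <- rs) ('X - r%:P))^`()).[z].
  by rewrite derivM derivXsubC mul1r hornerD hornerM hornerXsubC.
apply/andP; split.
  apply/negP => rrs; have := h r; rewrite rootM root_XsubC eqxx => /(_ isT)/negP[].
  rewrite /root dE subrr mul0r addr0; apply/eqP/rootP.
  by rewrite root_prod_XsubC.
apply: IH => z hz; apply/negP => hz'; have := h z; rewrite rootM hz orbT => /(_ isT)/negP[].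
by rewrite /root dE (rootP hz) (rootP hz') mulr0 addr0.
Qed.

Lemma card_eq_uniq (T : eqType) (xs : seq T) (A : set T) : uniq xs ->
  (forall y, A y <-> y \in xs) -> (A #= `I_(size xs))%card.
Proof.
move=> ux hA; apply/card_set_bijP; exists (index^~ xs); split.
- by move=> y /hA; rewrite /= index_mem.
- move=> y y'; rewrite !inE => /hA yx /hA y'x e.
  by rewrite -(nth_index y yx) e nth_index.
- move=> i /=; case: xs ux hA => [//|x0 xs] ux hA hi.
  exists (nth x0 (x0 :: xs) i); first by apply/hA; exact: mem_nth.
  by rewrite index_uniq.
Qed.

(** For z other than 0 and infinity the fibre is the root set of a polynomial of degree p + 1, whose
    roots are simple since a multiple one would be a ramification point. The value infinity is
    excluded because s = 1 is ramified. *)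
Lemma zetaP1_degree : has_degree (@zetaP1 R p) p.+1.
Proof.
move=> [z|] hq; last first.
  case: hq; exists (Some 1); first by rewrite /= eqxx.
  by rewrite /ramified_at; have [] := zeta_local1.
have K0 := belyi_const_neq0.
have [z0|z0] := eqVneq z 0.
  (* Infinity lies over 0 and is ramified when p > 1; for p = 1 the fibre consists of 0 and
     infinity. *)
  rewrite z0 in hq *; have [p1|p1] := ltnP 1 p.
    by case: hq; exists None; last exact: ramified_infty.
  have -> : p.+1 = size [:: Some (0 : C); None].
    by congr _.+1; apply/eqP; rewrite eqn_leq p1.
  apply: card_eq_uniq => // -[s|]; rewrite !inE //= orbF.
  have [->|s1] := eqVneq s 1; first by split=> // /eqP[] /eqP; rewrite oner_eq0.
  have s0 : 1 - s != 0 by rewrite subr_eq0 eq_sym.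
  split=> [[] /eqP|/eqP[->]]; last by rewrite zetaE mul0r mulr0.
  rewrite zetaE mulf_eq0 oppr_eq0 (negbTE K0) /= mulf_eq0 invr_eq0.
  by rewrite expf_eq0 (negbTE s0) andbF orbF => /eqP ->.
(* This is z (1 - s)^(p+1) + K s; the sign allows the monic X - 1 to replace 1 - X. *)
pose Q : {poly C} := (z * (-1) ^+ p.+1) *: ('X - 1%:P) ^+ p.+1 + K *: 'X.
have c0 : z * (-1) ^+ p.+1 != 0 by rewrite mulf_neq0// expf_neq0// oppr_eq0 oner_eq0.
have QE s : Q.[s] = z * (1 - s) ^+ p.+1 + K * s.
  rewrite /Q hornerD !hornerZ hornerX horner_exp hornerXsubC -mulrA -exprMn.
  by rewrite mulN1r opprB.
have dQE s : (Q^`()).[s] = z * (-1) ^+ p.+1 * (p.+1%:R * (s - 1) ^+ p) + K.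
  rewrite /Q derivD !derivZ derivX deriv_exp derivXsubC mul1r.
  by rewrite hornerD !hornerZ hornerMn horner_exp hornerXsubC hornerC mulr1 mulr_natl.
have sQ : size Q = p.+2.
  have sX : size ((z * (-1) ^+ p.+1) *: ('X - 1%:P) ^+ p.+1)%R = p.+2.
    by rewrite size_scale// size_exp_XsubC.
  by rewrite /Q size_polyDl sX// (leq_ltn_trans (size_scale_leq _ _))// size_polyX.
have [rs Qrs] := closed_field_poly_normal Q.
have lc0 : lead_coef Q != 0 by rewrite lead_coef_eq0 -size_poly_eq0 sQ.
have rootE s : root (\prod_(r <- rs) ('X - r%:P)) s = (Q.[s] == 0).
  by rewrite [in RHS]Qrs hornerZ mulf_eq0 (negbTE lc0).
have drootE s : root (\prod_(r <- rs) ('X - r%:P))^`() s = ((Q^`()).[s] == 0).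
  by rewrite [in RHS]Qrs derivZ hornerZ mulf_eq0 (negbTE lc0).
(* Q(1) = K is nonzero, so clearing the denominator adds no root at the pole. *)
have Q1 s : Q.[s] = 0 -> s != 1.
  move=> /eqP; apply: contraTneq => ->.
  by rewrite QE subrr expr0n mulr0 add0r mulr1.
have QzP s : s != 1 -> (Q.[s] == 0) = (zeta p s == z).
  move=> s1; have s0 : (1 - s) ^+ p.+1 != 0 by rewrite expf_neq0// subr_eq0 eq_sym.
  have -> : Q.[s] = (z - zeta p s) * (1 - s) ^+ p.+1.
    by rewrite QE zetaE; move: (K) => k; field.
  by rewrite mulf_eq0 (negbTE s0) orbF subr_eq0 eq_sym.
have srs : size rs = p.+1.
  by apply: succn_inj; rewrite -sQ Qrs size_scale// size_prod_XsubC.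
rewrite -srs -(size_map (@Some C)); apply: card_eq_uniq.
  rewrite map_inj_uniq; last by move=> ? ? [].
  apply: uniq_roots_simple => s; rewrite rootE drootE => /eqP Qs.
  have s1 := Q1 _ Qs; apply/negP => /eqP dQs; apply: hq; exists (Some s).
    by rewrite /= (negbTE s1); congr Some; apply/eqP; rewrite -QzP// Qs.
  apply/(ramified_finiteP s1); apply: (mulfI K0); rewrite mulr0.
  (* The combination (1 - s) Q' + (p + 1) Q equals K (1 + p s), so a common zero of Q and Q' is a
     critical point. *)
  have : (1 - s) * (Q^`()).[s] + p.+1%:R * Q.[s] = 0 by rewrite Qs dQs !mulr0 addr0.
  rewrite dQE QE => <-; have -> : s - 1 = -1 * (1 - s) by ring.
  rewrite exprMn -[p.+1%:R]natr1 !exprS.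
  have e1 : (-1) ^+ p * (-1) ^+ p = 1 :> C by rewrite -exprMn mulrNN mulr1 expr1n.
  transitivity (K * (1 + p%:R * s) + z * (p%:R + 1) * (1 - s) * (1 - s) ^+ p *
    (1 - (-1) ^+ p * (-1) ^+ p)); last by ring.
  by rewrite e1 subrr mulr0 addr0.
move=> [s|]; last first.
  split=> [[/esym /eqP]|/mapP[] //]; by rewrite (negbTE z0).
rewrite mem_map; last by move=> ? ? [].
rewrite -root_prod_XsubC rootE /=; have [->|s1] := eqVneq s 1.
  by split=> // /eqP/Q1; rewrite eqxx.
by rewrite QzP//; split=> [[/eqP]|/eqP ->].
Qed.

End BelyiMap.

Theorem theorem7p1 (R : realType) (p : nat) (hp : (1 <= p)%N) :
  let n := p.+1 in
  [/\ Belyi_map (@zetaP1 R p) /\ has_degree (@zetaP1 R p) n,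
      forall (a : R[i]) (l : int),
        let up := [seq (a + j%:R) / n%:R | j <- iota 0 n] in
        let low := [seq (a - l%:~R + j%:R) / p%:R | j <- iota 1 p] in
        lower_ok low ->
        (forall k : nat, f_coef_defined l (- a) (- p%:R) k) ->
        \forall s \near (0 : R[i]),
          hyp_cvg up low (zeta p s) /\
          hyp up low (zeta p s) =
            cpow (1 - s) a * F l (- a) (- p%:R) (1 - s)^-1
    & forall (a c : R[i]) (l : nat), (l <= 1)%N ->
        let up := rcons [seq (a + j%:R) / n%:R | j <- iota 0 n]
                        ((a + c - l%:R) / p%:R) in
        let low := rcons [seq (a - l%:R + j%:R) / p%:R | j <- iota 0 p]
                         ((a + c - l%:R + p%:R) / p%:R) in
        let Gup := G_up l (- a) (- p%:R) (- c) in
        let Glow := G_low l (- a) (- p%:R) (- c) in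
        lower_ok low -> lower_ok Glow ->
        \forall s \near (0 : R[i]),
          let y := (1 - s)^-1 in
          [/\ hyp_cvg up low (zeta p s),
              hyp_cvg Gup Glow ((y - 1) / y)
            & hyp up low (zeta p s) =
                cpow (1 - s) a * G l (- a) (- p%:R) (- c) y]].
Proof.
move=> n; split.
- by split; [exact: zetaP1_Belyi | exact: zetaP1_degree].
- by move=> a l; exact: hypergeometric_F.
- by move=> a c l; exact: hypergeometric_G.
Qed.
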